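(* Let $\alpha=\{x,y_1,\ldots,y_{n-1}\}$ be a partially ordered set with $n$ elements, with distinguished element $x$, and for $j\in\{1,\ldots,n\}$ let $N_j$ be the number of linear extensions $\sigma:\alpha\to\{1,\ldots,n\}$ with $\sigma(x)=j$. Let $i\in\{2,\ldots,n-1\}$ be such that $N_i>0$. Then the following are equivalent: (a) $N_i^2=N_{i+1}N_{i-1}$. (b) $N_i=N_{i+1}=N_{i-1}$. (c) Every linear extension $\sigma:\alpha\to\{1,\ldots,n\}$ with $\sigma(x)=i$ assigns ranks $i-1$ and $i+1$ to elements of $\alpha$ that are incomparable to $x$. (d) $|\alpha_{<y}|>i$ for all $y\in\alpha_{>x}$, and $|\alpha_{>y}|>n-i+1$ for all $y\in\alpha_{<x}$.
   Context: A linear extension of $\alpha$ is an order-preserving bijection $\sigma:\alpha\to\{1,\ldots,n\}$; $\sigma(z)$ is called the rank of $z$. For $z\in\alpha$, $\alpha_{<z}:=\{y\in\alpha:y<z\}$ and $\alpha_{>z}:=\{y\in\alpha:y>z\}$, with respect to the partial order of $\alpha$. *)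

(* Defs.v *)
From mathcomp Require Import all_boot all_order.

Set Implicit Arguments.
Unset Strict Implicit.
Unset Printing Implicit Defensive.

Section LinearExtensions.

Context {d : Order.disp_t} {T : finPOrderType d} {n : nat}.
Implicit Types (sigma : {ffun T -> 'I_n}) (x z : T).

(* 'I_n is {0, ..., n - 1}, whereas ranks live in {1, ..., n}. *)
Definition rank sigma z : nat := (sigma z).+1.

Definition is_linear_extension sigma : bool :=
  [&& injectiveb sigma,
      [forall k : 'I_n, exists z : T, sigma z == k]
    & [forall y : T, forall z : T,
         (y <= z)%O ==> (rank sigma y <= rank sigma z)%N]].

Definition linear_extensions_at x (j : nat) : {set {ffun T -> 'I_n}} :=
  [set sigma | is_linear_extension sigma & rank sigma x == j].

End LinearExtensions.

Section Counts.

Context {d : Order.disp_t} {T : finPOrderType d}.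

Definition num_linear_extensions_at (x : T) (j : nat) : nat :=
  #|linear_extensions_at (n := #|T|) x j|.

Definition strictly_below (z : T) : {set T} := [set y | (y < z)%O].
Definition strictly_above (z : T) : {set T} := [set y | (z < y)%O].

End Counts.

(* Main.v *)
(** Chan and Pak's combinatorial atlas.  Deleting elements of the poset from the
    bottom or from the top, one organizes the counts [N_(i+1)], [N_i], [N_(i-1)]
    of every subposet into one symmetric nonnegative matrix [M], with
    [N_(i+1) = <f, M f>], [N_i = <f, M g>], [N_(i-1) = <g, M g>] for the
    indicators [f] of bottom and [g] of top deletions.  By induction on the
    size of the subposet [M] is hyperbolic (it has at most one positive
    eigenvalue), so that [N_i ^ 2 >= N_(i+1) * N_(i-1)].  Equality forces
    [M f = s M g]; reading this row by row and using the inequality for the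
    subposets with one element less, the equality passes to every subposet
    obtained by deleting the first or the last letter of a linear extension,
    down to three letters [a, x, b], where it says that [a] and [b] are
    incomparable to [x].  This is (a) => (c).  For (c) => (d) a violation of (d)
    leaves room for a linear extension in which [x] is adjacent to a comparable
    element, and for (d) => (b) swapping [x] with its neighbour is a bijection. *)

Require Import Defs.
From mathcomp Require Import all_boot all_order.
From mathcomp Require Import all_algebra perm ring lra zify.

Set Implicit Arguments.
Unset Strict Implicit.
Unset Printing Implicit Defensive.

Import Order.TTheory GRing.Theory Num.Theory.

(** * Hyperbolic quadratic forms *)

(** The induction rests on an inheritance: row [i] of the matrix of [Y], applied to a vector, is a
    value of the form of the smaller set [Y :\ i.2], because a count on [Y] without two elements
    splits over a third removal. [pull] bounds the whole form by those smaller forms, so their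
    hyperbolicity gives [<u, M u> <= \sum_i h i * (M u) i ^ 2 / (M h) i], and from this the Bochner
    argument derives hyperbolicity. The obstacle is that this argument wants a strictly positive [h]
    and a connected support, while each of the two indicators vanishes somewhere. Hence third
    removals are weighted by [t > 0] at the bottom and [s > 0] at the top. This produces the mixture
    [t * N_(r+1) + s * N_r], whose support is connected, and a single count is reached as an end
    point of a segment of mixtures. A positivity criterion for the counts, in terms of the numbers
    of elements below and above the distinguished one, settles the supports and also the vanishing
    terms of the equality case. *)

Section Forms.

Local Open Scope ring_scope.

Variables (R : realFieldType) (I : finType).
Implicit Types (M : I -> I -> R) (u v w h : I -> R).

Definition act M v (i : I) : R := \sum_j M i j * v j.
Definition form M u v : R := \sum_i u i * act M v i.

Definition hyperbolic M : Prop :=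
  forall u v, 0 < form M v v -> form M u u * form M v v <= form M u v ^+ 2.

Lemma eq_form M M' u u' v v' : (forall i j, M i j = M' i j) ->
  u =1 u' -> v =1 v' -> form M u v = form M' u' v'.
Proof.
move=> eM eu ev; apply: eq_bigr => i _; rewrite eu; congr (_ * _).
by apply: eq_bigr => j _; rewrite eM ev.
Qed.

Lemma hyperbolic_ext M M' : (forall i j, M i j = M' i j) ->
  hyperbolic M -> hyperbolic M'.
Proof.
move=> eM hM u v; have e a b : form M' a b = form M a b by apply/esym/eq_form.
by rewrite !e; apply: hM.
Qed.

Lemma formC M u v : (forall i j, M i j = M j i) -> form M u v = form M v u.
Proof.
move=> sM; rewrite /form /act; under eq_bigr do rewrite mulr_sumr.
rewrite exchange_big /=; apply: eq_bigr => j _; rewrite mulr_sumr.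
by apply: eq_bigr => i _; rewrite (sM i j); ring.
Qed.

Lemma formDl M u v w c :
  form M (fun i => u i + c * v i) w = form M u w + c * form M v w.
Proof.
rewrite /form mulr_sumr -big_split /=; apply: eq_bigr => i _; ring.
Qed.

Lemma actD M u v c i :
  act M (fun i => u i + c * v i) i = act M u i + c * act M v i.
Proof. by rewrite /act mulr_sumr -big_split /=; apply: eq_bigr => j _; ring. Qed.

Lemma formDr M u v w c :
  form M w (fun i => u i + c * v i) = form M w u + c * form M w v.
Proof.
rewrite /form mulr_sumr -big_split /=; apply: eq_bigr => i _.
by rewrite actD; ring.
Qed.

Lemma formDM M M' c u v :
  form (fun i j => M i j + c * M' i j) u v = form M u v + c * form M' u v.
Proof.
rewrite /form mulr_sumr -big_split /=; apply: eq_bigr => i _.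
rewrite mulrCA -mulrDr; congr (_ * _).
by rewrite /act mulr_sumr -big_split /=; apply: eq_bigr => j _; ring.
Qed.

Lemma form_ge0 M u v : (forall i j, 0 <= M i j) -> (forall i, 0 <= u i) ->
  (forall i, 0 <= v i) -> 0 <= form M u v.
Proof.
move=> M0 u0 v0; apply: sumr_ge0 => i _; apply: mulr_ge0 => //.
by apply: sumr_ge0 => j _; apply: mulr_ge0.
Qed.

(** Shift [u] along [v] into the kernel of [l]. With [a], [b], [c] the values at [(u, u)], [(u, v)],
    [(v, v)], one has [a c - b ^ 2 = c (a + 2 r b + r ^ 2 c) - (b + r c) ^ 2], where the first
    bracket is the value at the shifted vector. *)
Lemma hyperbolic_of_functional M (l : (I -> R) -> R) :
    (forall i j, M i j = M j i) ->
    (forall u v c, l (fun i => u i + c * v i) = l u + c * l v) ->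
    (forall u, l u = 0 -> form M u u <= 0) ->
  hyperbolic M.
Proof.
move=> sM lD neg u v vv0.
have lv : l v != 0 by apply: contraTneq vv0 => /neg; rewrite leNgt.
pose r := - (l u / l v).
have := neg (fun i => u i + r * v i); rewrite lD /r mulNr divfK // subrr.
move=> /(_ erefl); rewrite formDl !formDr (formC v u sM) -/r.
move: (form M u u) (form M u v) (form M v v) vv0 => a b c c0 le0.
have : (a + r * b + r * (b + r * c)) * c <= 0.
  by rewrite pmulr_lle0.
have := sqr_ge0 (b + r * c); nra.
Qed.

(* Both sides are polynomial in the parameter, so hyperbolicity passes to the
   end point of a segment. *)
Lemma hyperbolic_limit M M' :
  (forall t : R, 0 < t < 1 -> hyperbolic (fun i j => (1 - t) * M i j + t * M' i j)) ->
  hyperbolic M.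
Proof.
move=> hyp u v vv0; rewrite leNgt; apply/negP => lt0.
have key (t : R) : 0 < t < 1 ->
    0 < (1 - t) * form M v v + t * form M' v v ->
    ((1 - t) * form M u u + t * form M' u u) *
      ((1 - t) * form M v v + t * form M' v v) <=
    ((1 - t) * form M u v + t * form M' u v) ^+ 2.
  have fE x y : (1 - t) * form M x y + t * form M' x y =
      form (fun i j => (1 - t) * M i j + t * M' i j) x y.
    rewrite formDM; congr (_ + _); rewrite /form mulr_sumr.
    apply: eq_bigr => i _; rewrite mulrCA; congr (_ * _).
    by rewrite /act mulr_sumr; apply: eq_bigr => j _; ring.
  by rewrite !fE => t01; apply: hyp.
move: key vv0 lt0.
move: (form M u u) (form M u v) (form M v v).
move: (form M' u u) (form M' u v) (form M' v v) => a' b' c' a b c key c0 lt0.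
(* A failure at [t = 0] survives for small [t]: [be] and [ga] are the coefficients of [t] and
   [t ^ 2] in the determinant of the mixed form on [u] and [v], and [K] is so large that at
   [t = e / K] they cannot use up the margin [e]. *)
pose be := a * (c' - c) + c * (a' - a) - 2 * b * (b' - b).
pose ga := (a' - a) * (c' - c) - (b' - b) ^+ 2.
pose e := Num.min c (a * c - b ^+ 2).
have e0 : 0 < e by rewrite lt_min c0 subr_gt0.
have [ec ed] : e <= c /\ e <= a * c - b ^+ 2 by rewrite !ge_min !lexx orbT.
pose K : R := 1 + `|c' - c| + `|be| + `|ga| + e.
have [n1 n2 n3] : [/\ 0 <= `|c' - c|, 0 <= `|be| & 0 <= `|ga|] by [].
have K0 : 0 < K by rewrite /K; lra.
pose t : R := e / K.
have tK : t * K = e by rewrite divfK ?gt_eqF.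
have t0 : 0 < t by rewrite divr_gt0.
have t1 : t < 1 by rewrite ltr_pdivrMr // /K; lra.
have /ler_normlP[c1 _] := lexx `|c' - c|.
have /ler_normlP[b1 _] := lexx `|be|.
have /ler_normlP[g1 _] := lexx `|ga|.
have ct : 0 < (1 - t) * c + t * c'.
  have : 0 <= t * (`|c' - c| + (c' - c)) by rewrite mulr_ge0 ?(ltW t0)//; lra.
  have : 0 <= t * `|be| by rewrite mulr_ge0 ?(ltW t0).
  have : 0 <= t * `|ga| by rewrite mulr_ge0 ?(ltW t0).
  have : 0 <= t * e by rewrite mulr_ge0 ?(ltW t0) ?(ltW e0).
  by move: tK; rewrite /K; lra.
have := key t; rewrite t0 t1 => /(_ isT ct).
have -> : ((1 - t) * a + t * a') * ((1 - t) * c + t * c') =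
  ((1 - t) * b + t * b') ^+ 2 + (a * c - b ^+ 2 + t * be + t ^+ 2 * ga).
  by rewrite /be /ga; ring.
have : 0 <= t * (`|be| + be) by rewrite mulr_ge0 ?(ltW t0)//; lra.
have : 0 <= t ^+ 2 * (`|ga| + ga) by rewrite mulr_ge0 ?sqr_ge0//; lra.
have : 0 <= t * (1 - t) * `|ga|.
  by rewrite mulr_ge0 // mulr_ge0 ?(ltW t0) // subr_ge0 ltW.
have : 0 <= t * `|c' - c| by rewrite mulr_ge0 ?(ltW t0).
have : 0 <= t * e by rewrite mulr_ge0 ?(ltW t0) ?(ltW e0).
move: tK; rewrite /K; lra.
Qed.

Lemma cauchy_schwarz M u v : (forall i j, M i j = M j i) ->
  (forall w, 0 <= form M w w) -> form M u v ^+ 2 <= form M u u * form M v v.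
Proof.
move=> sM psd.
have q r s : 0 <= r ^+ 2 * form M u u + (2 * r * s) * form M u v + s ^+ 2 * form M v v.
  have := psd (fun i => (0 + r * u i) + s * v i).
  rewrite !formDr !formDl (formC v u sM).
  have z1 w : form M (fun=> 0) w = 0.
    by rewrite /form big1 // => i _; rewrite mul0r.
  have z2 w : form M w (fun=> 0) = 0.
    by rewrite /form big1 // => i _; rewrite /act big1 ?mulr0 // => j _; rewrite mulr0.
  rewrite !z1 !z2; congr (_ <= _); ring.
move: (form M u u) (form M u v) (form M v v) q => a b c q.
have a0 : 0 <= a by have := q 1 0; nra.
have [aE|an] := eqVneq a 0.
  (* The test vector [- (c + 1) u + b v] has value [- (c + 2) b ^ 2], which forces [b = 0]. *)
  rewrite aE mul0r; have := q (- (c + 1)) b; rewrite aE => h.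
  have c0 : 0 <= c by have := q 0 1; nra.
  have := sqr_ge0 b; nra.
have ap : 0 < a by rewrite lt_def an.
have := q (- b) a; nra.
Qed.

Lemma solvable_of_ker0 (Q : I -> I -> R) :
  (forall u, (forall i, act Q u i = 0) -> forall i, u i = 0) ->
  forall b : I -> R, exists u, forall i, act Q u i = b i.
Proof.
move=> ker0 b.
pose A := \matrix_(i < #|I|, j < #|I|) Q (enum_val j) (enum_val i).
have actE (r : 'rV[R]_#|I|) k :
    (r *m A) 0 k = act Q (fun i => r 0 (enum_rank i)) (enum_val k).
  rewrite mxE /act (reindex (@enum_val _ I)) /=; last first.
    by exists enum_rank => i _; rewrite ?enum_valK ?enum_rankK.
  by apply: eq_bigr => j _; rewrite mxE enum_valK mulrC.
have uA : A \in unitmx.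
  rewrite -row_free_unit -kermx_eq0; apply/rowV0P => r /sub_kermxP rA.
  apply/rowP => k; rewrite mxE -(enum_valK k).
  apply: (ker0 (fun i => r 0 (enum_rank i))) => i.
  by rewrite -(enum_rankK i) -actE rA mxE.
exists (fun i => ((\row_k b (enum_val k)) *m invmx A) 0 (enum_rank i)) => i.
by rewrite -{1}(enum_rankK i) -actE mulmxKV // mxE enum_rankK.
Qed.

(* The Bochner method without eigenvalues: with [D] the diagonal matrix making
   [h] a fixed vector of [D^-1 M], solve [(D - M) u = D w] and compare [u] and
   [w] by Cauchy-Schwarz for the Laplacian [D - M]. *)
Lemma bochner M h :
    (forall i j, M i j = M j i) -> (forall i j, 0 <= M i j) ->
    (forall i, 0 < h i) ->
    (forall p : I -> R, (forall k l, M k l != 0 -> p k = p l) ->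
       forall i j, act M h i != 0 -> act M h j != 0 -> p i = p j) ->
    (forall u, form M u u <= \sum_i h i * act M u i ^+ 2 / act M h i) ->
  forall w, form M w h = 0 -> form M w w <= 0.
Proof.
move=> sM M0 h0 conn star w wh0.
pose D i := act M h i / h i.
have Dh i : D i * h i = act M h i by rewrite divfK ?gt_eqF.
have D0 i : 0 <= D i.
  rewrite divr_ge0 ?(ltW (h0 i)) // sumr_ge0 // => j _.
  by rewrite mulr_ge0 ?(ltW (h0 j)).
have Dn0 i : D i != 0 -> act M h i != 0.
  by apply: contra => /eqP e; rewrite /D e mul0r.
have actD0 i : D i = 0 -> forall u, act M u i = 0.
  move=> Di0 u; have /eqP := Dh i; rewrite Di0 mul0r eq_sym /act.
  rewrite psumr_eq0 => [|j _]; last by rewrite mulr_ge0 ?(ltW (h0 j)).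
  move/allP=> Mi0; rewrite big1 // => j _.
  have := Mi0 j (mem_index_enum j); rewrite mulf_eq0 [h j == 0]gt_eqF // orbF.
  by move/eqP=> ->; rewrite mul0r.
pose L i j := (i == j)%:R * D i - M i j.
have sL i j : L i j = L j i.
  rewrite /L sM eq_sym; congr (_ - _).
  by case: eqP => [->|]; rewrite ?mul0r.
have diag (a : I -> R) u i : \sum_j ((i == j)%:R * a i) * u j = a i * u i.
  rewrite (bigD1 i) //= eqxx mul1r big1 ?addr0 // => j /negPf ne.
  by rewrite eq_sym ne !mul0r.
have actL u i : act L u i = D i * u i - act M u i.
  rewrite -diag /act -sumrB; apply: eq_bigr => j _; rewrite /L; ring.
have formL u v : form L u v = \sum_i D i * u i * v i - form M u v.
  rewrite /form -sumrB; apply: eq_bigr => i _; rewrite actL; ring.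
(* After rescaling by [h], the matrix [D - M] is a weighted graph Laplacian in the quotients
   [u i / h i]. *)
have dirichlet u : form L u u =
    2^-1 * \sum_i \sum_j M i j * h i * h j * (u i / h i - u j / h j) ^+ 2.
  have e1 : \sum_i D i * u i * u i =
      \sum_i \sum_j M i j * h j * u i ^+ 2 / h i.
    apply: eq_bigr => i _; rewrite /D /act !mulr_suml.
    by apply: eq_bigr => j _; ring.
  have e2 : \sum_i D i * u i * u i =
      \sum_i \sum_j M i j * h i * u j ^+ 2 / h j.
    rewrite e1 exchange_big /=; apply: eq_bigr => i _; apply: eq_bigr => j _.
    by rewrite sM.
  have e3 : form M u u = \sum_i \sum_j M i j * u i * u j.
    apply: eq_bigr => i _; rewrite /act mulr_sumr.
    by apply: eq_bigr => j _; ring.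
  apply: (mulfI (_ : 2 != 0 :> R)); first by rewrite pnatr_eq0.
  rewrite mulrA divff ?pnatr_eq0 // mul1r formL.
  transitivity (\sum_i D i * u i * u i + \sum_i D i * u i * u i
                - 2 * form M u u); first by ring.
  rewrite {1}e1 e2 e3 mulr_sumr -sumrN -!big_split /=.
  apply: eq_bigr => i _; rewrite mulr_sumr -sumrN -!big_split /=.
  apply: eq_bigr => j _; have hi := h0 i; have hj := h0 j.
  by field; rewrite !gt_eqF.
have term0 u i j :
    0 <= M i j * h i * h j * (u i / h i - u j / h j) ^+ 2.
  apply: mulr_ge0 (sqr_ge0 _); apply: mulr_ge0 (ltW (h0 j)).
  exact: mulr_ge0 (M0 i j) (ltW (h0 i)).
have L0 u : 0 <= form L u u.
  rewrite dirichlet mulr_ge0 ?invr_ge0 ?ler0n //.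
  by apply: sumr_ge0 => i _; apply: sumr_ge0.
pose s u := \sum_j D j * h j * u j.
(* [L] is singular: it kills [h], and its rows with [D i = 0] vanish. The identity on those rows and
   the square of the functional [s] are added to make it injective; connectivity says that [L] has
   no further kernel. *)
pose Q i j := L i j + (i == j)%:R * (D i == 0)%:R + D i * h i * (D j * h j).
have actQ u i :
    act Q u i = act L u i + (D i == 0)%:R * u i + D i * h i * s u.
  rewrite -(diag (fun i => (D i == 0)%:R)) /act /s mulr_sumr -!big_split /=.
  by apply: eq_bigr => j _; rewrite /Q; ring.
have formQ u :
    \sum_i u i * act Q u i = form L u u + \sum_i (D i == 0)%:R * u i ^+ 2 + s u ^+ 2.
  have -> : s u ^+ 2 = \sum_i u i * (D i * h i * s u).
    rewrite expr2 {1}/s mulr_suml; apply: eq_bigr => i _; ring.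
  by rewrite /form -!big_split /=; apply: eq_bigr => i _; rewrite actQ; ring.
have [u Qu] : exists u, forall i, act Q u i = D i * w i.
  apply: solvable_of_ker0 => u Qu0.
  have E0 : 0 <= \sum_i (D i == 0)%:R * u i ^+ 2.
    by apply: sumr_ge0 => i _; rewrite mulr_ge0 ?ler0n ?sqr_ge0.
  have sum0 := formQ u.
  rewrite big1 in sum0 => [|i _]; last by rewrite Qu0 mulr0.
  have S0 := sqr_ge0 (s u); have Lu := L0 u.
  have {Lu} /eqP Lu0 : form L u u = 0 by lra.
  have {E0} /eqP Eu0 : \sum_i (D i == 0)%:R * u i ^+ 2 = 0 by lra.
  have {S0 sum0} /eqP su0 : s u ^+ 2 = 0 by lra.
  move: su0; rewrite sqrf_eq0 => /eqP su0.
  have off i : D i = 0 -> u i = 0.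
    move=> Di; move: Eu0; rewrite psumr_eq0 => [/allP|j _]; last first.
      by rewrite mulr_ge0 ?ler0n ?sqr_ge0.
    move/(_ i (mem_index_enum i)); rewrite Di eqxx mul1r sqrf_eq0.
    by move/eqP.
  have edge k l : M k l != 0 -> u k / h k = u l / h l.
    move=> Mkl; move: Lu0; rewrite dirichlet mulf_eq0 invr_eq0 pnatr_eq0 /=.
    rewrite psumr_eq0 => [/allP/(_ k (mem_index_enum k))|i _]; last exact: sumr_ge0.
    rewrite /= psumr_eq0 => [/allP/(_ l (mem_index_enum l))|//].
    rewrite /= mulf_eq0 sqrf_eq0 subr_eq0 => /orP[|/eqP //].
    by rewrite mulf_eq0 mulf_eq0 (negPf Mkl) ![h _ == 0]gt_eqF.
  move=> i; have [/off//|Di] := eqVneq (D i) 0.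
  have cst j : D j * h j * u j = D j * h j ^+ 2 * (u i / h i).
    have [->|Dj] := eqVneq (D j) 0; first by rewrite !mul0r.
    rewrite -(conn _ edge _ _ (Dn0 _ Dj) (Dn0 _ Di)).
    by have hj := h0 j; field; rewrite gt_eqF.
  move: su0; rewrite /s (eq_bigr _ (fun j _ => cst j)) -mulr_suml => /eqP.
  rewrite mulf_eq0 psumr_eq0; last by move=> j _; rewrite mulr_ge0 ?sqr_ge0.
  case/orP=> [/allP/(_ i (mem_index_enum i))|].
    by rewrite /= mulf_eq0 (negPf Di) sqrf_eq0 gt_eqF.
  by rewrite mulf_eq0 invr_eq0 [h i == 0]gt_eqF // orbF => /eqP.
have off i : D i = 0 -> u i = 0.
  move=> Di; have := Qu i; rewrite actQ actL Di eqxx actD0 // !mul0r mul1r.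
  by rewrite subr0 add0r addr0.
(* Pair the equation with [h]: [L] kills [h], and the right-hand side pairs to [form M w h = 0]. So
   the added square vanishes at the solution. *)
have sD i : D i * h i * s u = 0.
  have [->|Di] := eqVneq (D i) 0; first by rewrite !mul0r.
  have e : \sum_j h j * act Q u j = form M w h.
    by apply: eq_bigr => j _; rewrite Qu -Dh; ring.
  have hL : form L h u = 0.
    rewrite formC // /form big1 // => j _.
    by rewrite actL Dh subrr mulr0.
  have : \sum_j h j * act Q u j = form L h u + (\sum_j D j * h j ^+ 2) * s u.
    rewrite /form mulr_suml -big_split /=; apply: eq_bigr => j _; rewrite actQ.
    have -> : (D j == 0)%:R * u j = 0.
      by case: eqP => [/off ->|_]; rewrite ?mulr0 ?mul0r.
    by ring.
  rewrite e wh0 hL add0r => /esym/eqP; rewrite mulf_eq0 psumr_eq0; last first.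
    by move=> j _; rewrite mulr_ge0 ?sqr_ge0.
  case/orP=> [/allP/(_ i (mem_index_enum i))|/eqP ->]; last by rewrite mulr0.
  by rewrite /= mulf_eq0 (negPf Di) sqrf_eq0 gt_eqF.
have Lu i : act L u i = D i * w i.
  by rewrite -Qu actQ sD addr0; case: eqP => [/off ->|_]; rewrite ?mulr0 ?mul0r addr0.
have Mu i : act M u i = D i * (u i - w i).
  by have e := actL u i; rewrite Lu in e; rewrite mulrBr e; ring.
(* Since [M u = D (u - w)], the hypothesis at [u] reads [\sum D u (u - w) <= \sum D (u - w) ^ 2]. *)
have uw : \sum_i D i * u i * w i <= \sum_i D i * w i ^+ 2.
  have h1 := star u; rewrite -subr_ge0 /form -sumrB in h1.
  rewrite -subr_ge0 -sumrB.
  apply: le_trans h1 _; rewrite le_eqVlt; apply/orP; left; apply/eqP.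
  apply: eq_bigr => i _; rewrite Mu -Dh.
  have [->|Di] := eqVneq (D i) 0; first by ring.
  by have hi := h0 i; field; rewrite Di gt_eqF.
have Lwu : form L w u = \sum_i D i * w i ^+ 2.
  by apply: eq_bigr => i _; rewrite Lu; ring.
have Luu : form L u u = \sum_i D i * u i * w i.
  by apply: eq_bigr => i _; rewrite Lu; ring.
have Lww : form L w w = \sum_i D i * w i ^+ 2 - form M w w.
  by rewrite formL; congr (_ - _); apply: eq_bigr => i _; ring.
(* With [a = \sum D w ^ 2] and [b = \sum D u w <= a] this reads [a ^ 2 <= (a - form M w w) b], so
   [form M w w] cannot be positive. *)
have := cauchy_schwarz w u sL L0; have := L0 w; rewrite Lwu Luu Lww.
have : 0 <= \sum_i D i * w i ^+ 2.
  by apply: sumr_ge0 => i _; rewrite mulr_ge0 ?sqr_ge0.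
move: (\sum_i D i * w i ^+ 2) (\sum_i _) (form M w w) uw => a b m ba a0 Lw cs.
have [aE|an] := eqVneq a 0; first by lra.
have ap : 0 < a by rewrite lt_def an.
nra.
Qed.

(** The vector [f - s g] is isotropic and orthogonal to [g]. On the complement of [g] the form is
    nonpositive, so an isotropic vector there is orthogonal to the whole complement; being
    orthogonal to [g] as well, it lies in the kernel of [M]. *)
Lemma hyperbolic_eq M f g s :
    (forall i j, M i j = M j i) -> hyperbolic M -> 0 < form M g g ->
    form M f g = s * form M g g -> form M f f = s * form M f g ->
  forall i, act M f i = s * act M g i.
Proof.
move=> sM hyp gg0 fg ff i.
have [w [wg ww wE]] : exists w, [/\ form M w g = 0, form M w w = 0 &
    act M w i = act M f i + (- s) * act M g i].
  exists (fun j => f j + (- s) * g j); split; last exact: actD.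
    by rewrite formDl fg; ring.
  by rewrite formDl !formDr (formC g f sM) ff fg; ring.
have orth v : form M v g = 0 -> form M v w = 0.
  move=> vg; have le0 t : 2 * t * form M v w + form M v v <= 0.
    have := hyp (fun j => v j + t * w j) g.
    rewrite gg0 => /(_ isT); rewrite !formDl !formDr vg wg ww (formC w v sM).
    rewrite !mulr0 !addr0 expr0n /= pmulr_lle0 //.
    by apply: le_trans; rewrite le_eqVlt; apply/orP; left; apply/eqP; ring.
  apply/eqP; case: eqP => // /eqP n0.
  (* This value of [t] makes the left-hand side of [le0] equal to one. *)
  have := le0 ((1 - form M v v) / (2 * form M v w)).
  have -> : 2 * ((1 - form M v v) / (2 * form M v w)) * form M v w =
      1 - form M v v by field.
  by lra.
have all0 v : form M v w = 0.
  have := orth (fun j => v j + (- (form M v g / form M g g)) * g j).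
  rewrite !formDl (formC g w sM) wg mulr0 addr0; apply.
  by rewrite mulNr divfK ?subrr // gt_eqF.
have : form M (fun j => (j == i)%:R) w = act M w i.
  rewrite /form (bigD1 i) //= eqxx mul1r big1 ?addr0 // => j /negPf ->.
  by rewrite mul0r.
by rewrite all0 wE; lra.
Qed.

End Forms.

(** * Linear extensions of subposets as words *)

Section Words.

Variables (T : finType) (le : rel T).
Hypotheses (le_refl : reflexive le) (le_anti : antisymmetric le)
  (le_trans : transitive le).
Variable z : T.
Implicit Types (Y Z : {set T}) (i j k : bool * T).

Definition slt a b := (a != b) && le a b.
(** For reflexive [le] this also excludes repeated letters, so the [lin] words with letter set [Y]
    are the linear extensions of [Y]. *)
Definition lin (w : seq T) := pairwise (fun a b => ~~ le b a) w.

Lemma slt_irr a : slt a a = false.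
Proof. by rewrite /slt eqxx. Qed.

Lemma slt_asym a b : slt a b -> slt b a -> False.
Proof.
by move=> /andP[/eqP ne ab] /andP[_ ba]; apply: ne; apply: le_anti; rewrite ab.
Qed.

Lemma slt_trans a b c : slt a b -> slt b c -> slt a c.
Proof.
move=> ab bc; have /andP[nab lab] := ab; have /andP[nbc lbc] := bc.
rewrite /slt (le_trans lab lbc) andbT; apply: contraTneq lbc => <-.
by apply: contra nab => ba; apply/eqP/le_anti; rewrite lab.
Qed.

Lemma lin_uniq w : lin w -> uniq w.
Proof. by apply: pairwise_uniq => a; rewrite /= le_refl. Qed.

Lemma lin_size w Y : lin w -> [set c in w] = Y -> size w = #|Y|.
Proof. by move=> /lin_uniq/card_uniqP <- <-; rewrite cardsE. Qed.

(* The pair [(true, a)] stands for the removal of [a] from the bottom,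
   [(false, a)] for its removal from the top. *)
Definition blocks (d : bool) c a := if d then slt c a else slt a c.
Definition removable Y i :=
  [&& i.2 \in Y, i.2 != z & [forall c in Y, ~~ blocks i.1 c i.2]].

Lemma removable_in Y i : removable Y i -> i.2 \in Y.
Proof. by case/and3P. Qed.

Lemma removable_neq Y i j : removable (Y :\ i.2) j -> j.2 != i.2.
Proof. by move/removable_in; rewrite !inE => /andP[]. Qed.

Lemma removable_sub Y i j :
  removable Y j -> j.2 != i.2 -> removable (Y :\ i.2) j.
Proof.
move=> /and3P[jY jz /forall_inP mj] ji; apply/and3P; split=> //.
  by rewrite !inE ji.
by apply/forall_inP => c; rewrite !inE => /andP[_ /mj].
Qed.

Lemma removable_blocked Y i j :
  removable (Y :\ i.2) j -> ~~ removable Y j -> blocks j.1 i.2 j.2.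
Proof.
move=> /and3P[]; rewrite !inE => /andP[ji jY] jz /forall_inP mj.
rewrite /removable jY jz /= negb_forall => /existsP[c]; rewrite negb_imply negbK.
case/andP=> cY bc; have [<-//|ci] := eqVneq c i.2.
by have := mj c; rewrite !inE ci cY bc => /(_ isT).
Qed.

(** Before its removal [i.2] blocked [j]; were the kinds opposite, [j.2] would in turn block [i].
    Hence a weight depending only on the kind is unchanged by [unblocked]. *)
Lemma removable_kind Y i j : removable Y i ->
  removable (Y :\ i.2) j -> ~~ removable Y j -> j.1 = i.1.
Proof.
move=> /and3P[_ _ /forall_inP mi] rj nj; have b := removable_blocked rj nj.
have jY : j.2 \in Y by move/removable_in: rj; rewrite !inE => /andP[].
have := mi _ jY; move: b; rewrite /blocks.
by case: i.1; case: j.1 => // ->.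
Qed.

(** A blocker of [k] in [Y] cannot be both [i.2] and [j.2], so it would survive one of the two
    deletions. *)
Lemma removable_two Y i j k : i.2 != j.2 -> removable (Y :\ i.2) k ->
  removable (Y :\ j.2) k -> removable Y k.
Proof.
move=> ij /and3P[]; rewrite !inE => /andP[ki kY] kz /forall_inP mi.
move=> /and3P[_ _ /forall_inP mj]; apply/and3P; split=> //.
apply/forall_inP => c cY; have [e|ci] := eqVneq c i.2.
  by apply: mj; rewrite !inE cY e ij.
by apply: mi; rewrite !inE cY ci.
Qed.

Lemma setD1C Y a b : Y :\ a :\ b = Y :\ b :\ a.
Proof. by apply/setP => c; rewrite !inE andbCA. Qed.

Lemma lin_cons a w Y : lin (a :: w) -> [set c in a :: w] = Y -> a != z ->
  [/\ removable Y (true, a), lin w & [set c in w] = Y :\ a].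
Proof.
move=> /andP[/allP la lw] eY az; split=> //.
  rewrite -eY; apply/and3P; split=> //=; first by rewrite !inE eqxx.
  apply/forall_inP => c; rewrite /slt !inE.
  by have [//|_ /= /la] := eqVneq c a.
apply/setP => c; rewrite -eY !inE; have [->|//] := eqVneq c a.
by apply/negP => /la; rewrite le_refl.
Qed.

Lemma lin_rcons b w Y : lin (rcons w b) -> [set c in rcons w b] = Y -> b != z ->
  [/\ removable Y (false, b), lin w & [set c in w] = Y :\ b].
Proof.
rewrite /lin pairwise_rcons => /andP[/allP lb lw] eY bz; split=> //.
  rewrite -eY; apply/and3P; split=> //=; first by rewrite inE mem_rcons mem_head.
  apply/forall_inP => c; rewrite inE mem_rcons inE /slt eq_sym.
  by have [//|_ /= /lb] := eqVneq c b.
apply/setP => c; rewrite -eY !inE mem_rcons inE; have [->|//] := eqVneq c b.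
by apply/negP => /lb; rewrite le_refl.
Qed.

(** [n] is the number of letters before [z], one less than the rank of [z]. *)
Definition words m Y n : {set m.-tuple T} :=
  [set w : m.-tuple T | [&& lin w, [set c in tval w] == Y & index z w == n]].
Definition num_words Y n := #|words #|Y| Y n|.

Lemma num_words_pos w Y : lin w -> [set c in w] = Y ->
  (0 < num_words Y (index z w))%N.
Proof.
move=> lw eY; apply/card_gt0P; exists (tcast (lin_size lw eY) (in_tuple w)).
by rewrite inE val_tcast lw eY !eqxx.
Qed.

(** A positive index keeps [z] off the first place, so the first letter can be stripped. *)
Lemma num_words_down Y n : num_words Y n.+1 =
  (\sum_(a | removable Y (true, a)) num_words (Y :\ a) n)%N.
Proof.
rewrite /num_words; case EY: #|Y| => [|m].
  rewrite big1 => [|a /removable_in /=]; last by rewrite (cards0_eq EY) inE.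
  by apply: eq_card0 => w; rewrite /words inE (tuple0 w) !andbF.
rewrite -sum1_card (partition_big (fun w : m.+1.-tuple T => thead w)
  (fun a => removable Y (true, a))) /=; last first.
  move=> w; rewrite inE; case/tupleP: w => a w /=; rewrite theadE.
  case/and3P=> lw /eqP eY; have [//|az _] := eqVneq a z.
  by have [] := lin_cons lw eY az.
apply: eq_bigr => a ra; have aY := removable_in ra.
have -> : #|Y :\ a| = m by move: EY; rewrite (cardsD1 a) aY => -[].
rewrite sum1dep_card -(card_imset _ (f := fun t : m.-tuple T => [tuple of a :: t])).
  2: by move=> s t /(congr1 val)[] /val_inj.
apply: eq_card => w; rewrite !inE; apply/idP/imsetP.
  case/tupleP: w => b w /=; rewrite theadE => /andP[/and3P[lw /eqP eY]].
  have [//|bz ik /eqP ba] := eqVneq b z; subst b.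
  have [_ lw' eY'] := lin_cons lw eY bz.
  exists w; last exact: val_inj.
  by rewrite inE lw' eY' eqxx.
case=> t; rewrite inE => /and3P[lt1 /eqP eY /eqP ik] ->.
have /and3P[_ az /forall_inP ma] := ra.
rewrite theadE eqxx andbT /= lt1 andbT; apply/and3P; split.
- apply/allP => c ct; have : c \in Y :\ a by rewrite -eY inE.
  rewrite !inE => /andP[ca cY]; have := ma _ cY; by rewrite /= /slt ca.
- rewrite -(setD1K aY) -eY; apply/eqP/setP => c; by rewrite !inE.
- by rewrite /= in az; rewrite (negPf az) ik.
Qed.

(** The bound on [n] keeps [z] off the last place; stripping the last letter leaves the index of [z]
    unchanged. *)
Lemma num_words_up Y n : (n.+1 < #|Y|)%N -> num_words Y n =
  (\sum_(b | removable Y (false, b)) num_words (Y :\ b) n)%N.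
Proof.
rewrite /num_words; case EY: #|Y| => [//|m] km.
rewrite -sum1_card (partition_big (fun w : m.+1.-tuple T => last z w)
  (fun b => removable Y (false, b))) /=; last first.
  move=> w; rewrite inE; have := size_tuple w.
  case/lastP E: (tval w) => [//|s b]; rewrite size_rcons last_rcons => -[sm].
  case/and3P=> lw /eqP eY; rewrite -cats1 index_cat; case: ifP => [zs _|_]; last first.
    by rewrite /= sm; case: (b == z) => /eqP; lia.
  have bz : b != z.
    apply: contraTneq zs => <-; have := lin_uniq lw.
    by rewrite rcons_uniq => /andP[].
  by have [] := lin_rcons lw eY bz.
apply: eq_bigr => b rb; have bY := removable_in rb.
have Em : #|Y :\ b| = m by move: EY; rewrite (cardsD1 b) bY => -[].
rewrite Em sum1dep_card
  -(card_imset _ (f := fun t : m.-tuple T => [tuple of rcons t b])).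
  2: by move=> s t /(congr1 val)/= /rcons_inj[] /val_inj.
apply: eq_card => w; rewrite !inE; apply/idP/imsetP.
  have := size_tuple w.
  case/lastP E: (tval w) => [//|s b']; rewrite size_rcons last_rcons => -[sm].
  move=> /andP[/and3P[lw /eqP eY ik] /eqP e]; subst b'.
  have [_ ls eY'] := lin_rcons lw eY (let: And3 _ bz _ := and3P rb in bz).
  exists (tcast sm (in_tuple s)); last by apply: val_inj; rewrite /= val_tcast.
  rewrite inE val_tcast /= ls eY' eqxx /=.
  move: ik; rewrite -cats1 index_cat; case: ifP => // zs.
  by rewrite /= sm; case: (b == z) => /eqP; lia.
case=> t; rewrite inE => /and3P[lt1 /eqP eY /eqP ik] ->.
have /and3P[_ bz /forall_inP mb] := rb.
have zt : z \in t by rewrite -index_mem ik size_tuple; lia.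
rewrite /= last_rcons eqxx andbT /lin pairwise_rcons -andbA; apply/and4P; split=> //.
- apply/allP => c ct; have : c \in Y :\ b by rewrite -eY inE.
  rewrite !inE => /andP[cb cY]; have := mb _ cY; by rewrite /= /slt eq_sym cb.
- rewrite -(setD1K bY) -eY; apply/eqP/setP => c; by rewrite !inE mem_rcons inE.
- by rewrite -cats1 index_cat zt ik.
Qed.

End Words.

(** * The atlas *)

Section Atlas.

Local Open Scope ring_scope.

Variables (R : realFieldType) (T : finType) (le : rel T) (z : T).
Local Notation rmv := (removable le z).
Implicit Types (Y Z : {set T}) (i j k : bool * T) (u w h : bool * T -> R).
Implicit Types (G : {set T} -> R).

(* The entry at two removable [i != j] is [G] of [Y] without both elements.  The
   diagonal entry at [i] collects the [k] that become removable only after [i],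
   so that row [i] sums [G] over all ways to remove [i] and then one more. *)
Definition unblocked Y i j := if rmv Y j then j else i.

Definition atlas G Y i j : R :=
  (rmv Y i)%:R * \sum_(k | rmv (Y :\ i.2) k)
    G (Y :\ i.2 :\ k.2) * (unblocked Y i k == j)%:R.

(** One more removal, weighted by [h]. When [G] is a count this is a mixture of two consecutive
    counts, see [lift_num_words]. *)
Definition lift h G Z : R := \sum_(k | rmv Z k) h k * G (Z :\ k.2).

Lemma act_atlas G Y w i : act (atlas G Y) w i =
  (rmv Y i)%:R * \sum_(k | rmv (Y :\ i.2) k)
    G (Y :\ i.2 :\ k.2) * w (unblocked Y i k).
Proof.
rewrite /act /atlas; under eq_bigr do rewrite -mulrA mulr_suml.
rewrite -mulr_sumr exchange_big /=; congr (_ * _); apply: eq_bigr => k _.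
rewrite (bigD1 (unblocked Y i k)) //= eqxx mulr1 big1 ?addr0 // => j ne.
by rewrite eq_sym (negPf ne) mulr0 mul0r.
Qed.

Lemma form_atlas G Y u w : form (atlas G Y) u w =
  \sum_i \sum_k [&& rmv Y i & rmv (Y :\ i.2) k]%:R *
    (G (Y :\ i.2 :\ k.2) * u i * w (unblocked Y i k)).
Proof.
apply: eq_bigr => i _; rewrite act_atlas; case: (rmv Y i) => /=; last first.
  by rewrite mul0r mulr0 big1 // => k _; rewrite mul0r.
rewrite mul1r mulr_sumr big_mkcond; apply: eq_bigr => k _.
by case: (rmv _ k); rewrite ?mul0r // mul1r; ring.
Qed.

Lemma atlas_offdiag G Y i j : i != j -> atlas G Y i j =
  [&& rmv Y i, rmv Y j & i.2 != j.2]%:R * G (Y :\ i.2 :\ j.2).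
Proof.
move=> ij; rewrite /atlas; case ri: (rmv Y i); rewrite /= ?mul0r // mul1r.
rewrite big_mkcond (bigD1 j) //= big1 ?addr0 => [|k kj]; last first.
  case: ifP => // _; rewrite /unblocked; case: ifP => _.
    by rewrite (negPf kj) mulr0.
  by rewrite (negPf ij) mulr0.
rewrite /unblocked; case rj: (rmv Y j) => /=; last first.
  by rewrite (negPf ij) mulr0 mul0r if_same.
rewrite eqxx mulr1; case: ifP => [/removable_neq|/negP rij].
  by rewrite eq_sym => ->; rewrite mul1r.
case: eqP => [|/eqP e]; first by rewrite mul0r.
by case: rij; apply: removable_sub; rewrite // eq_sym.
Qed.

Lemma atlasC G Y i j : atlas G Y i j = atlas G Y j i.
Proof.
have [->//|ij] := eqVneq i j; have ji : j != i by rewrite eq_sym.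
by rewrite !atlas_offdiag // setD1C andbCA (eq_sym i.2).
Qed.

Lemma atlas_ge0 G Y i j : (forall Z, 0 <= G Z) -> 0 <= atlas G Y i j.
Proof.
by move=> G0; rewrite mulr_ge0 ?sumr_ge0 // => k _; rewrite mulr_ge0.
Qed.

Lemma eq_atlas G G' Y :
  (forall i k, rmv Y i -> rmv (Y :\ i.2) k ->
     G (Y :\ i.2 :\ k.2) = G' (Y :\ i.2 :\ k.2)) ->
  forall i j, atlas G Y i j = atlas G' Y i j.
Proof.
move=> eG i j; rewrite /atlas; case ri: (rmv Y i); rewrite ?mul0r //.
by congr (_ * _); apply: eq_bigr => k rk; rewrite eG.
Qed.

Lemma atlasD G G' (c c' : R) Y i j :
  atlas (fun Z => c * G Z + c' * G' Z) Y i j =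
  c * atlas G Y i j + c' * atlas G' Y i j.
Proof.
rewrite /atlas !mulr_sumr -big_split /=.
by apply: eq_bigr => k _; ring.
Qed.

Lemma kind_unblocked h Y i k : (forall i j, i.1 = j.1 -> h i = h j) ->
  rmv Y i -> rmv (Y :\ i.2) k -> h (unblocked Y i k) = h k.
Proof.
move=> hk ri rk; rewrite /unblocked; case: ifPn => // nk.
by apply/esym/hk; apply: removable_kind rk nk.
Qed.

(** The inheritance of rows: [w] is pulled back along [unblocked Y i], while [h], a function of the
    kind, is its own pull-back. *)
Lemma act_lift G Y h w i : (forall i j, i.1 = j.1 -> h i = h j) ->
  act (atlas (lift h G) Y) w i =
  (rmv Y i)%:R *
    form (atlas G (Y :\ i.2)) (fun j => w (unblocked Y i j)) h.
Proof.
move=> hk; rewrite act_atlas; case ri: (rmv Y i); rewrite ?mul0r // !mul1r.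
rewrite form_atlas big_mkcond; apply: eq_bigr => j _.
case rj: (rmv _ j) => /=; last by rewrite big1 // => k _; rewrite mul0r.
rewrite /lift mulr_suml big_mkcond; apply: eq_bigr => k _.
case rk: (rmv _ k); rewrite ?mul0r // mul1r.
by rewrite (kind_unblocked hk rj rk); ring.
Qed.

(* After cancelling equal terms, the difference of the two sides is a sum of
   [h * G * (w i - w j) ^+ 2] over the pairs of removable elements [i], [j]
   that together block a third one. *)
Lemma pull G Y h w : (forall i j, i.1 = j.1 -> h i = h j) ->
    (forall i, 0 <= h i) -> (forall Z, 0 <= G Z) ->
  form (atlas (lift h G) Y) w w <=
  \sum_i (rmv Y i)%:R * (h i * form (atlas G (Y :\ i.2))
    (fun j => w (unblocked Y i j)) (fun j => w (unblocked Y i j))).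
Proof.
move=> hk h0 G0.
pose G3 i j k := G (Y :\ i.2 :\ j.2 :\ k.2).
pose ch i j k := [&& rmv Y i, rmv (Y :\ i.2) j & rmv (Y :\ i.2 :\ j.2) k].
pose S (f : bool * T -> bool * T -> bool * T -> R) :=
  \sum_i \sum_j \sum_k f i j k.
have S12 f : S f = S (fun i j k => f j i k) by rewrite /S exchange_big.
have S23 f : S f = S (fun i j k => f i k j).
  by apply: eq_bigr => i _; rewrite exchange_big.
have SD f g : S (fun i j k => f i j k + g i j k) = S f + S g.
  rewrite /S -big_split; apply: eq_bigr => i _; rewrite -big_split.
  by apply: eq_bigr => j _; rewrite -big_split.
have eqS f g : (forall i j k, f i j k = g i j k) -> S f = S g.
  move=> e; apply: eq_bigr => i _; apply: eq_bigr => j _.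
  by apply: eq_bigr => k _.
have leS f g : (forall i j k, f i j k <= g i j k) -> S f <= S g.
  move=> e; apply: ler_sum => i _; apply: ler_sum => j _.
  by apply: ler_sum => k _.
have -> : form (atlas (lift h G) Y) w w = S (fun i j k =>
    (ch i j k)%:R * G3 i j k * (h k * w i * w (unblocked Y i j))).
  rewrite form_atlas; apply: eq_bigr => i _; apply: eq_bigr => j _.
  rewrite /lift !mulr_suml mulr_sumr big_mkcond; apply: eq_bigr => k _.
  rewrite /ch /G3; case: (rmv Y i); case: (rmv _ j); case: (rmv _ k);
    by rewrite /= ?mul0r ?mul1r //; ring.
have -> : \sum_i (rmv Y i)%:R * (h i * form (atlas G (Y :\ i.2))
    (fun j => w (unblocked Y i j)) (fun j => w (unblocked Y i j))) =
  S (fun i j k => (ch i j k)%:R * G3 i j k * (h i * w (unblocked Y i j) *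
       w (unblocked Y i (unblocked (Y :\ i.2) j k)))).
  apply: eq_bigr => i _; rewrite form_atlas !mulr_sumr; apply: eq_bigr => j _.
  rewrite !mulr_sumr; apply: eq_bigr => k _.
  by rewrite /ch /G3; case: (rmv Y i); rewrite /= ?mul0r ?mul1r //; ring.
pose dep i k := rmv (Y :\ i.2) k && ~~ rmv Y k.
(* A chain [i, j, k] of removals is classified by what [Y] itself allows: in [t1] everything, in
   [t2], [t3], [t4] only [k] has to wait, for [i], for [j], or for both; in [t5] only [j] waits, in
   [t6] both [j] and [k]. *)
pose t1 i j k := [&& ch i j k, rmv Y j & rmv Y k].
pose t2 i j k := [&& ch i j k, rmv Y j & dep i k].
pose t3 i j k := [&& ch i j k, rmv Y j & dep j k].
pose t4 i j k := [&& ch i j k, rmv Y j,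
  ~~ rmv (Y :\ i.2) k & ~~ rmv (Y :\ j.2) k].
pose t5 i j k := [&& ch i j k, ~~ rmv Y j & rmv Y k].
pose t6 i j k := [&& ch i j k, ~~ rmv Y j & ~~ rmv Y k].
have chk i j k : ch i j k -> [/\ i.2 != j.2, i.2 != k.2 & j.2 != k.2].
  case/and3P=> _ /removable_neq ji rk; rewrite eq_sym ji.
  have := removable_in rk; rewrite !inE => /and3P[kj ki _].
  by rewrite eq_sym ki eq_sym kj.
have rsub i k : rmv Y k -> i.2 != k.2 -> rmv (Y :\ i.2) k.
  by move=> rk ik; apply: removable_sub; rewrite // eq_sym.
have two i j k : i.2 != j.2 -> rmv (Y :\ i.2) k -> rmv (Y :\ j.2) k ->
  rmv Y k by exact: removable_two.
pose g i j k := G3 i j k.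
have termA i j k :
  (ch i j k)%:R * G3 i j k * (h i * w (unblocked Y i j) *
       w (unblocked Y i (unblocked (Y :\ i.2) j k))) =
  (t1 i j k)%:R * g i j k * (h i * w j * w k) +
  (t2 i j k)%:R * g i j k * (h i * w j * w i) +
  (t3 i j k)%:R * g i j k * (h i * w j * w j) +
  (t4 i j k)%:R * g i j k * (h i * w j * w j) +
  (t5 i j k)%:R * g i j k * (h i * w i * w k) +
  (t6 i j k)%:R * g i j k * (h i * w i * w i).
  rewrite /t1 /t2 /t3 /t4 /t5 /t6 /dep /g /unblocked.
  case c: (ch i j k) => /=; last by rewrite !mul0r !addr0.
  have [ij ik jk] := chk _ _ _ c; have /and3P[ri rj rk] := c.
  case: (boolP (rmv Y j)) => rYj /=; case: (boolP (rmv Y k)) => rYk /=.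
  - by rewrite (rsub _ _ rYk ik) (rsub _ _ rYk jk) rYk /=; ring.
  - case: (boolP (rmv (Y :\ i.2) k)) => rik /=.
      rewrite (negPf rYk) /= andbT.
      case: (boolP (rmv (Y :\ j.2) k)) => rjk /=; last by ring.
      by rewrite (two _ _ _ ij rik rjk) in rYk.
    rewrite rYj; case: (rmv (Y :\ j.2) k) => /=; ring.
  - by rewrite (rsub _ _ rYk ik) rYk /=; ring.
  - case: (boolP (rmv (Y :\ i.2) k)) => rik /=.
      by rewrite (negPf rYk); ring.
    by rewrite (negPf rYj); ring.
have kind1 i j k : ch i j k -> ~~ rmv (Y :\ i.2) k -> h k = h j.
  by case/and3P=> _ rj rk nk; apply/hk; apply: removable_kind rk nk.
have kind2 i k : rmv Y i -> dep i k -> h k = h i.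
  by move=> ri /andP[rk nk]; apply/hk; apply: removable_kind rk nk.
have swap i j k : ch i j k -> rmv Y j -> ch j i k.
  move=> c rj; have [ij ik jk] := chk _ _ _ c; have /and3P[ri _ rk] := c.
  by rewrite /ch rj rsub 1?eq_sym //= setD1C.
have termB i j k :
  (ch i j k)%:R * G3 i j k * (h k * w i * w (unblocked Y i j)) =
  (t1 i j k)%:R * g i j k * (h k * w i * w j) +
  (t2 i j k)%:R * g i j k * (h i * w i * w j) +
  (t3 i j k)%:R * g i j k * (h j * w i * w j) +
  (t4 i j k)%:R * g i j k * (h i * w i * w j) +
  (t5 i j k)%:R * g i j k * (h k * w i * w i) +
  (t6 i j k)%:R * g i j k * (h i * w i * w i).
  rewrite /t1 /t2 /t3 /t4 /t5 /t6 /g /unblocked.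
  case c: (ch i j k) => /=; last by rewrite !mul0r !addr0.
  have [ij ik jk] := chk _ _ _ c; have /and3P[ri rj rk] := c.
  case: (boolP (rmv Y j)) => rYj /=; case: (boolP (rmv Y k)) => rYk /=.
  - rewrite /dep rYk (rsub _ _ rYk ik) (rsub _ _ rYk jk) /=; ring.
  - case: (boolP (dep i k)) => [di|/nandP[rik|/negP//]].
      rewrite (kind2 _ _ ri di).
      have -> : dep j k = false.
        apply/negP => /andP[rjk _]; case/andP: di => rik.
        by rewrite (two _ _ _ ij rik rjk).
      by case/andP: di => -> _ /=; ring.
    case: (boolP (dep j k)) => [dj|/nandP[rjk|/negP//]].
      by rewrite (kind2 _ _ rYj dj); case/andP: dj => -> _; rewrite /= andbF /=; ring.
    rewrite rik rjk (kind1 j i k) //=; first by ring.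
    exact: swap.
  - by ring.
  - suff -> : h k = h i by ring.
    have hj : h j = h i by apply: kind2; rewrite // /dep rYj rj.
    case: (boolP (rmv (Y :\ i.2) k)) => rik; last by rewrite (kind1 i j k).
    by apply: kind2; rewrite // /dep rik.
rewrite (eqS _ _ termA) (eqS _ _ termB) !SD {termA termB}.
have g12 i j k : g j i k = g i j k.
  by rewrite /g /G3 (setD1C Y j.2 i.2).
have g23 i j k : g i k j = g i j k.
  by rewrite /g /G3 (setD1C _ k.2 j.2).
have c23 i j k : ch i j k -> rmv (Y :\ i.2) k -> ch i k j.
  move=> c rik; have [ij ik jk] := chk _ _ _ c; have /and3P[ri rj rk] := c.
  rewrite /ch ri rik /=; apply: (removable_sub (Y := Y :\ i.2) (i := k)) => //.
have t1_12 i j k : t1 i j k = t1 j i k.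
  by apply/idP/idP => /and3P[c r1 r2]; rewrite /t1 (swap _ _ _ c r1) r2;
    case/and3P: c => ->.
have t1_23 i j k : t1 i j k = t1 i k j.
  apply/idP/idP => /and3P[c r1 r2]; rewrite /t1 r1 r2 /= andbT c23 //;
    by have [ij ik jk] := chk _ _ _ c; apply: rsub.
have t23 i j k : t3 i j k = t2 j i k.
  by apply/idP/idP => /and3P[c r1 r2]; rewrite /t2 /t3 (swap _ _ _ c r1) r2;
    case/and3P: c => ->.
have t25 i j k : t5 i j k = t2 i k j.
  apply/idP/idP.
    move=> /and3P[c r1 r2]; have [ij ik jk] := chk _ _ _ c.
    have /and3P[ri rj rk] := c.
    by rewrite /t2 c23 ?rsub // r2 /dep rj r1.
  move=> /and3P[c r1 /andP[r2 r3]]; by rewrite /t5 c23 // r3 r1.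
have t44 i j k : t4 i j k = t4 j i k.
  by apply/idP/idP => /and4P[c r1 r2 r3]; rewrite /t4 (swap _ _ _ c r1) r2 r3;
    case/and3P: c => ->.
have e1 : S (fun i j k => (t1 i j k)%:R * g i j k * (h k * w i * w j)) =
          S (fun i j k => (t1 i j k)%:R * g i j k * (h i * w j * w k)).
  rewrite S23 S12; apply: eqS => i j k.
  by rewrite -t1_23 -t1_12 g23 g12; ring.
have e3 x : S (fun i j k => (t3 i j k)%:R * g i j k * x i j k) =
          S (fun i j k => (t2 i j k)%:R * g i j k * x j i k).
  by rewrite S12; apply: eqS => i j k; rewrite t23 g12.
have e5 x : S (fun i j k => (t5 i j k)%:R * g i j k * x i j k) =
          S (fun i j k => (t2 i j k)%:R * g i j k * x i k j).
  by rewrite S23; apply: eqS => i j k; rewrite t25 g23.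
have b2 : S (fun i j k => (t2 i j k)%:R * g i j k * (h i * w i * w j)) =
          S (fun i j k => (t2 i j k)%:R * g i j k * (h i * w j * w i)).
  by apply: eqS => i j k; ring.
(* [t3] and [t5] are relabellings of [t2], which match the [t3] terms of either side with the [t5]
   terms of the other. The [t6] terms agree as they stand. *)
have b3 : S (fun i j k => (t3 i j k)%:R * g i j k * (h j * w i * w j)) =
          S (fun i j k => (t5 i j k)%:R * g i j k * (h i * w i * w k)).
  by rewrite e3 e5; apply: eqS => i j k; ring.
have b5 : S (fun i j k => (t5 i j k)%:R * g i j k * (h k * w i * w i)) =
          S (fun i j k => (t3 i j k)%:R * g i j k * (h i * w j * w j)).
  by rewrite e3 e5; apply: eqS => i j k; ring.
have b4 : S (fun i j k => (t4 i j k)%:R * g i j k * (h i * w i * w j)) <=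
          S (fun i j k => (t4 i j k)%:R * g i j k * (h i * w j * w j)).
  have e4 : S (fun i j k => (t4 i j k)%:R * g i j k * (h i * w j * w j)) =
            S (fun i j k => (t4 i j k)%:R * g i j k * (h i * w i * w i)).
    rewrite S12; apply: eqS => i j k; rewrite -t44 g12.
    case t: (t4 i j k); last by rewrite !mul0r.
    have /and4P[c rj ni nj] := t.
    by rewrite -(kind1 i j k) // -(kind1 j i k) // swap.
  have : S (fun i j k => (t4 i j k)%:R * g i j k * (h i * w i * w j) +
              (t4 i j k)%:R * g i j k * (h i * w i * w j)) <=
         S (fun i j k => (t4 i j k)%:R * g i j k * (h i * w j * w j) +
              (t4 i j k)%:R * g i j k * (h i * w i * w i)).
    apply: leS => i j k; rewrite -!mulrDr ler_wpM2l ?mulr_ge0 //; first exact: G0.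
    by have := mulr_ge0 (h0 i) (sqr_ge0 (w i - w j)); lra.
  by rewrite !SD -e4; lra.
rewrite e1 b2 b3 b5; lra.
Qed.

(** The estimate that [bochner] asks for is [pull], followed in each row by hyperbolicity of the
    smaller form at the pulled-back vector and [h]. *)
Lemma hyperbolic_lift G Y h : (forall i j, i.1 = j.1 -> h i = h j) ->
    (forall i, 0 < h i) -> (forall Z, 0 <= G Z) ->
    (forall p : bool * T -> R,
       (forall k l, atlas (lift h G) Y k l != 0 -> p k = p l) ->
       forall i j, act (atlas (lift h G) Y) h i != 0 ->
         act (atlas (lift h G) Y) h j != 0 -> p i = p j) ->
    (forall i, rmv Y i -> hyperbolic (atlas G (Y :\ i.2))) ->
  hyperbolic (atlas (lift h G) Y).
Proof.
move=> hk h0 G0 conn hyp; have h0' i := ltW (h0 i).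
have L0 Z : 0 <= lift h G Z by apply: sumr_ge0 => k _; rewrite mulr_ge0.
apply: (@hyperbolic_of_functional _ _ _ (fun u => form (atlas (lift h G) Y) u h)).
- exact: atlasC.
- by move=> u v c; rewrite formDl.
apply: bochner => //; [exact: atlasC | by move=> i j; apply: atlas_ge0 |].
move=> u; apply: le_trans (pull Y u hk h0' G0) _; apply: ler_sum => i _.
rewrite !act_lift //; case ri: (rmv Y i); last by rewrite !mul0r expr0n mulr0 mul0r.
set v := fun j => u (unblocked Y i j); pose A := atlas G (Y :\ i.2).
rewrite -/A !mul1r.
have -> : form A (fun j => h (unblocked Y i j)) h = form A h h.
  rewrite /A !form_atlas; apply: eq_bigr => j _; apply: eq_bigr => k _.
  case rj: (rmv (Y :\ i.2) j); last by rewrite !mul0r.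
  by rewrite (kind_unblocked hk ri rj).
rewrite -mulrA ler_wpM2l //.
have A0 j k : 0 <= A j k by apply: atlas_ge0.
have : 0 <= form A h h by apply: form_ge0.
rewrite le_eqVlt => /predU1P[/esym/eqP c0|c0]; last first.
  by rewrite ler_pdivlMr // hyp.
(* As [h] is positive and [A] nonnegative, [form A h h = 0] means [A = 0]. *)
suff -> : form A v v = 0 by rewrite mulr_ge0 ?sqr_ge0 // invr_ge0 form_ge0.
rewrite /form big1 // => j _; rewrite /act big1 ?mulr0 // => k _.
have act0 m : 0 <= act A h m by apply: sumr_ge0 => l _; rewrite mulr_ge0.
move: c0; rewrite /form psumr_eq0 => [/allP/(_ j (mem_index_enum j))|l _].
  rewrite /= mulf_eq0 gt_eqF //= /act psumr_eq0 => [|l _]; last exact: mulr_ge0.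
  move/allP/(_ k (mem_index_enum k)); rewrite /= mulf_eq0 (gt_eqF (h0 k)) orbF.
  by move/eqP=> ->; rewrite mul0r.
exact: mulr_ge0.
Qed.

End Atlas.

(** * Positivity of the counts *)

Section Blockers.

Local Open Scope ring_scope.

Variables (T : finType) (le : rel T).
Hypotheses (le_refl : reflexive le) (le_anti : antisymmetric le)
  (le_trans : transitive le).
Variable z : T.
Local Notation rmv := (removable le z).
Local Notation slt := (slt le).
Local Notation blocks := (blocks le).
Local Notation num_words := (num_words le z).
Implicit Types (Y Z : {set T}) (i j k : bool * T).

Definition blockers d Y := #|[set c in Y | blocks d c z]|.

Lemma blockersD1 d Y a : a \in Y ->
  blockers d Y = (blocks d a z + blockers d (Y :\ a))%N.
Proof.
move=> aY; rewrite /blockers (cardsD1 a) inE aY /=; congr (_ + _)%N.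
by apply: eq_card => c; rewrite !inE andbA.
Qed.

Lemma leq_blockers d Y a : (blockers d (Y :\ a) <= blockers d Y)%N.
Proof.
apply/subset_leq_card/subsetP => c.
by rewrite !inE -andbA => /and3P[_ -> ->].
Qed.

Lemma blocks_irr d a : blocks d a a = false.
Proof. by case: d; rewrite /(blocks _ _ _) slt_irr. Qed.

Lemma blocks_trans d a b c : blocks d a b -> blocks d b c -> blocks d a c.
Proof. by case: d => /= ab bc; [exact: slt_trans bc | exact: slt_trans ab]. Qed.

Lemma blocksN d a b : blocks (~~ d) a b = blocks d b a.
Proof. by case: d. Qed.

Lemma blocks_asym d a b : blocks d a b -> blocks d b a -> False.
Proof. by case: d => /= ab ba; [exact: slt_asym ab ba | exact: slt_asym ba ab]. Qed.

Lemma ltn_blockers d Y : z \in Y ->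
  (blockers d Y + blockers (~~ d) Y < #|Y|)%N.
Proof.
move=> zY; rewrite (cardsD1 z Y) zY add1n ltnS -cardsUI.
have -> : [set c in Y | blocks d c z] :&: [set c in Y | blocks (~~ d) c z] = set0.
  apply/setP => c; rewrite !inE blocksN; apply/negP.
  by case/andP=> /andP[_ cz] /andP[_]; apply: blocks_asym.
rewrite cards0 addn0.
apply/subset_leq_card/subsetP => c; rewrite !inE -andb_orr => /andP[-> cz].
by rewrite andbT; apply: contraTneq cz => ->; rewrite !blocks_irr.
Qed.

Lemma exists_unblocked d (P : pred T) c : P c ->
  exists2 a, P a & forall b, P b -> ~~ blocks d b a.
Proof.
move=> Pc; case: (arg_minnP (fun a => #|[set b | blocks d b a]|) Pc) => a Pa amin.
exists a => // b Pb; apply/negP => ba; have := amin b Pb; rewrite leqNgt => /negP.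
apply; apply/proper_card/properP; split.
  by apply/subsetP => e; rewrite !inE => eb; apply: blocks_trans ba.
by exists b; rewrite !inE // blocks_irr.
Qed.

(** Descend from [c] to an element that nothing in [Y] blocks; the descent avoids [z] because [z]
    does not block [c]. *)
Lemma exists_removable d Y c : c \in Y -> c != z -> ~~ blocks d z c ->
  exists2 a, rmv Y (d, a) & a = c \/ blocks d a c.
Proof.
move=> cY cz zc.
pose below a := (a \in Y) && ((a == c) || blocks d a c).
have bc : below c by rewrite /below cY eqxx.
have [a /andP[aY /predU1P ac] amin] := exists_unblocked d bc; exists a => //.
apply/and3P; split=> //=.
  by case: ac => [-> //|ac]; apply: contraNneq zc => <-.
apply/forall_inP => b bY; apply/negP => ba.
have /amin : below b; last by rewrite ba.
by rewrite /below bY; case: ac => [<-|ac]; rewrite ?ba ?(blocks_trans ba ac) orbT.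
Qed.

Lemma removable_Nblocks d Y a : z \in Y -> rmv Y (d, a) -> ~~ blocks d z a.
Proof. by move=> zY /and3P[_ _ /forall_inP]; apply. Qed.

(** Elements below [z] must precede it and elements above must follow; nothing else constrains its
    place. The induction peels a last letter when [n = 0], and otherwise a first letter, chosen
    below [z] if possible. *)
Lemma num_words_gt0 Y n : z \in Y -> (0 < num_words Y n)%N =
  (blockers true Y <= n)%N && (n + blockers false Y < #|Y|)%N.
Proof.
elim/ltn_ind: {Y}#|Y| {-2}Y (erefl #|Y|) n => m IH Y Ym n zY.
have card1 a : a \in Y -> #|Y| = #|Y :\ a|.+1 by move=> aY; rewrite (cardsD1 a Y) aY.
have memz d a : rmv Y (d, a) -> z \in Y :\ a.
  by case/and3P=> /= _ az _; rewrite !inE eq_sym az.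
have step d a n' : rmv Y (d, a) -> (0 < num_words (Y :\ a) n')%N =
    (blockers true (Y :\ a) <= n')%N && (n' + blockers false (Y :\ a) < #|Y :\ a|)%N.
  move=> ra; apply: (IH #|Y :\ a|) => //; last exact: memz ra.
  by rewrite -Ym (card1 a (removable_in ra)).
case: n => [|n].
  have [Y1|Y1] := leqP #|Y| 1.
    have EY : Y = [set z].
      by apply/esym/eqP; rewrite eqEcard sub1set zY cards1.
    have b0 d : blockers d [set z] = 0%N.
      apply: eq_card0 => c; rewrite !inE; apply/negP => /andP[/eqP->].
      by rewrite blocks_irr.
    rewrite EY !b0 cards1 /=; apply/card_gt0P; rewrite /(num_words _ _) cards1.
    exists [tuple z]; rewrite inE /= eqxx !andbT; apply/eqP/setP => c.
    by rewrite !inE.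
  rewrite num_words_up //; apply/idP/idP => [|/andP[b0 _]].
    rewrite lt0n sum_nat_eq0 negb_forall => /existsP[b]; rewrite negb_imply -lt0n.
    case/andP=> rb; rewrite (step _ _ _ rb) => /andP[].
    have := blockersD1 true (removable_in rb); have := removable_Nblocks zY rb.
    rewrite /= => /negPf -> ->; rewrite add0n => -> _ /=.
    by have := ltn_blockers false zY; lia.
  have [c cY cz] : exists2 c, c \in Y & c != z.
    have := card_gt0P (_ : 0 < #|Y :\ z|)%N.
    case=> [|c]; first by move: (card1 z zY); lia.
    by rewrite !inE => /andP[cz cY]; exists c.
  have [|b rb _] := exists_removable (d := false) cY cz.
    apply/negP => /= lcz; move: b0; rewrite leqn0 cards_eq0 => /eqP/setP/(_ c).
    by rewrite !inE cY /= lcz.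
  rewrite (bigD1 b) //= ltn_addr // (step _ _ _ rb).
  have := leq_blockers true Y b; have := ltn_blockers false (memz _ _ rb); lia.
rewrite num_words_down //; apply/idP/idP => [|/andP[bt bf]].
  rewrite lt0n sum_nat_eq0 negb_forall => /existsP[a]; rewrite negb_imply -lt0n.
  case/andP=> ra; rewrite (step _ _ _ ra) => /andP[].
  have aY := removable_in ra.
  rewrite (blockersD1 true aY) (blockersD1 false aY) (card1 a aY) /=.
  have := removable_Nblocks zY ra => /= /negPf ->.
  by case: (slt a z) => /=; lia.
have [a ra ba] : exists2 a, rmv Y (true, a) & (blockers true (Y :\ a) <= n)%N.
  have [b0|b0] := posnP (blockers true Y).
    (* With nothing below [z], the upper bound on the index leaves an element incomparable to
       [z]. *)
    have [c] : exists c, c \in [set c in Y | (c != z) && ~~ blocks false c z].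
      apply/set0Pn; rewrite -cards_eq0 -lt0n.
      have : (#|Y| <= #|[set c in Y | (c != z) && ~~ blocks false c z]| +
          #|[set c in Y | blocks false c z]| + #|[set z]|)%N.
        apply: leq_trans (leq_add (leq_card_setU _ _) (leqnn _)).
        apply: leq_trans (leq_card_setU _ _); apply/subset_leq_card/subsetP => c cY.
        by rewrite !inE cY /=; case: (c == z); case: (slt z c).
      by rewrite cards1; move: bf; rewrite /blockers; lia.
    rewrite inE => /and3P[cY cz zc].
    have [a ra _] := exists_removable (d := true) cY cz zc.
    by exists a => //; have := leq_blockers true Y a; lia.
  have [c] := card_gt0P b0; rewrite inE => /andP[cY /= cz].
  have [|||a ra ac] := @exists_removable true Y c => //.
  - by apply: contraTneq cz => ->; rewrite slt_irr.
  - by apply/negP => /(slt_asym le_anti cz).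
  exists a => //; have := blockersD1 true (removable_in ra).
  have -> : blocks true (true, a).2 z by case: ac => [-> //|] /=; move/slt_trans; exact.
  by rewrite /=; lia.
rewrite (bigD1 a) //= ltn_addr // (step _ _ _ ra) ba /=.
have := leq_blockers false Y a; have := card1 a (removable_in ra); lia.
Qed.

End Blockers.

(** * Connected supports and the induction for hyperbolicity *)

Section Hyperbolicity.

Local Open Scope ring_scope.

Variables (T : finType) (le : rel T).
Hypotheses (le_refl : reflexive le) (le_anti : antisymmetric le)
  (le_trans : transitive le).
Variable z : T.
Local Notation rmv := (removable le z).
Local Notation slt := (slt le).
Local Notation blocks := (blocks le).
Local Notation num_words := (num_words le z).
Local Notation blockers := (blockers le z).
Implicit Types (Y Z : {set T}) (i j k : bool * T).

(** Connectivity as [bochner] wants it, for a support cut out by one bound at each end. If [Y]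
    exceeds a bound, all rows of the support are joined to a common one; otherwise any two removals
    of distinct elements are joined. *)
Lemma support_connected (R : realFieldType) (G : {set T} -> R)
    (bound : bool -> nat) Y :
    z \in Y -> (2 < #|Y|)%N -> #|Y| = (bound true + bound false + 2)%N ->
    (forall i k, rmv Y i -> rmv (Y :\ i.2) k ->
       (G (Y :\ i.2 :\ k.2) != 0) =
       [forall d, blockers d (Y :\ i.2 :\ k.2) <= bound d]%N) ->
  forall h (p : bool * T -> R),
    (forall k l, atlas le z G Y k l != 0 -> p k = p l) ->
  forall i j, act (atlas le z G Y) h i != 0 -> act (atlas le z G Y) h j != 0 ->
    p i = p j.
Proof.
move=> zY Y2 cY GE h p pE.
have edge i j : rmv Y i -> rmv Y j -> i.2 != j.2 ->
    (forall d, blockers d (Y :\ i.2 :\ j.2) <= bound d)%N -> p i = p j.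
  move=> ri rj ij bd; apply: pE; rewrite atlas_offdiag; last first.
    by apply: contraNneq ij => ->.
  rewrite ri rj ij mul1r GE //; first exact/forallP.
  by apply: removable_sub; rewrite // eq_sym.
have supp i : act (atlas le z G Y) h i != 0 -> rmv Y i /\
    exists2 k, rmv (Y :\ i.2) k &
      forall d, (blockers d (Y :\ i.2 :\ k.2) <= bound d)%N.
  rewrite act_atlas; case ri: (rmv Y i); last by rewrite mul0r eqxx.
  rewrite mul1r => n0; split=> //.
  case: (pickP (fun k => rmv (Y :\ i.2) k && (G (Y :\ i.2 :\ k.2) != 0))).
    by move=> k /andP[rk]; rewrite GE // => /forallP; exists k.
  move=> none; move: n0; rewrite big1 ?eqxx // => k rk.
  by have := none k; rewrite rk => /negbFE/eqP ->; rewrite mul0r.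
have cY' d : #|Y| = (bound d + bound (~~ d) + 2)%N by rewrite cY; case: d => /=; lia.
have flip (d d' : bool) : d' != d -> d' = ~~ d by case: d d' => -[].
have [d dY|small] := pickP (fun d => bound d < blockers d Y)%N.
  have [c] : exists c, c \in [set c in Y | blocks d c z].
    by apply/card_gt0P; apply: leq_ltn_trans dY.
  rewrite inE => /andP[cinY cz].
  have [||e re ec] := @exists_removable _ _ le_anti le_trans z d Y c cinY.
  - by apply: contraTneq cz => ->; rewrite blocks_irr.
  - by apply/negP; apply: blocks_asym cz.
  have ez : blocks d e z by case: ec => [->|/blocks_trans]; last exact.
  (* The centre [e] blocks [z], so removing it relieves end [d] at least as much as removing [k].
     The other end is within its bound already in [Y], since both kinds of blockers together number
     less than [#|Y|]. *)
  suff star i : act (atlas le z G Y) h i != 0 -> p i = p (d, e).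
    by move=> i j /star -> /star ->.
  case/supp=> ri [k rk bk]; have [-> //|ne] := eqVneq i (d, e).
  have ie : i.2 != e.
    apply: contra ne => /eqP ie; case: i ie {bk rk} ri => d' a /= -> ri.
    rewrite xpair_eqE eqxx andbT; apply/negPn/negP => dd.
    have E := flip _ _ dd.
    by have := removable_Nblocks zY ri; rewrite E blocksN ez.
  apply: edge => // d'.
  have eYi : e \in Y :\ i.2 by rewrite !inE eq_sym ie (removable_in re).
  have [->|dd] := eqVneq d' d.
    have := bk d; have := blockersD1 le z d (removable_in rk).
    rewrite (blockersD1 le z d eYi) ez => /= h1 h2.
    have := leq_b1 (blocks d k.2 z); move: h1 h2.
    by move: (_ d) (blockers d _) (blockers d _) (blocks d _ _ : nat); clear; lia.
  rewrite (flip _ _ dd).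
  apply: leq_trans (leq_blockers _ _ _ _ _) _.
  apply: leq_trans (leq_blockers _ _ _ _ _) _.
  move: dY (ltn_blockers le_anti d zY); rewrite (cY' d) /=.
  by move: (bound d) (bound _) (blockers d Y) (blockers _ Y); clear; lia.
have edge' i j : rmv Y i -> rmv Y j -> i.2 != j.2 -> p i = p j.
  move=> ri rj ij; apply: edge => // d; have := small d => /negbT; rewrite -leqNgt.
  apply: leq_trans; apply: leq_trans (leq_blockers _ _ _ _ _) _.
  exact: leq_blockers.
move=> i j /supp[ri _] /supp[rj _].
have [ij|] := eqVneq i.2 j.2; last exact: edge'.
have [->//|nij] := eqVneq i j.
(* The two removals of one element are joined through a removal of another. *)
suff [k rk ki] : exists2 k, rmv Y k & k.2 != i.2.
  by rewrite -(edge' k i) // (edge' k j) // -ij.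
have [rt rf] : rmv Y (true, i.2) /\ rmv Y (false, i.2).
  move: nij ri rj; case: i j ij => -[] a [[] b] /= <-; rewrite ?xpair_eqE ?eqxx //.
have [c] : exists c, c \in Y :\ z :\ i.2.
  apply/card_gt0P; have := cardsD1 z Y; have := cardsD1 i.2 (Y :\ z).
  by rewrite zY; case: (i.2 \in _) => /=; lia.
rewrite !inE => /and3P[ci cz cinY].
pose d := ~~ slt z c.
have [|a ra ac] := @exists_removable _ _ le_anti le_trans z d Y c cinY cz.
  rewrite /d; case E: (slt z c) => /=; last by rewrite E.
  by apply/negP => /(slt_asym le_anti E).
exists (d, a) => //=; apply: contraTneq (isT) => ai; case: ac => [ac|].
  by rewrite -ac ai eqxx in ci.
rewrite ai -blocksN; have /and3P[_ _ /forall_inP m] : rmv Y (~~ d, i.2).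
  by case: (~~ d).
by rewrite (negPf (m _ cinY)).
Qed.

Lemma atlas_base (R : realFieldType) Y : z \in Y -> #|Y| = 3 ->
  hyperbolic (atlas le z (fun=> 1 : R) Y).
Proof.
move=> zY Y3.
have [a [b [az bz ab EY]]] : exists a b,
    [/\ a != z, b != z, a != b & Y = [set z; a; b]].
  have : #|Y :\ z| = 2 by have := cardsD1 z Y; rewrite zY Y3 => -[].
  move=> /eqP/cards2P[a [b [ab E]]]; exists a, b; split=> //.
  - by have : a \in Y :\ z by [rewrite E !inE eqxx]; rewrite !inE => /andP[].
  - by have : b \in Y :\ z by [rewrite E !inE eqxx orbT]; rewrite !inE => /andP[].
  - by rewrite -(setD1K zY) E setUA.
wlog nba : a b az bz ab EY / ~~ slt b a.
  move=> wl; case: (boolP (slt b a)) => [ba|]; last exact: (wl a b).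
  apply: (wl b a) => //; first by rewrite eq_sym.
    by rewrite EY -setUA (setUC [set a]) setUA.
  by apply/negP; apply: slt_asym ba.
have ba : b != a by rewrite eq_sym.
have sums f : (forall i : bool * T, i.2 != a -> i.2 != b -> f i = 0 :> R) ->
    \sum_i f i = f (true, a) + f (false, a) + f (true, b) + f (false, b).
  move=> f0; transitivity (\sum_(i : bool * T) f (i.1, i.2)).
    by apply: eq_bigr => -[].
  rewrite -(pair_bigA _ (fun d c => f (d, c))) big_bool /=.
  have s d : \sum_c f (d, c) = f (d, a) + f (d, b).
    rewrite (bigD1 a) //= (bigD1 b) //= big1 ?addr0 // => c /andP[ca cb].
    exact: f0.
  by rewrite !s; ring.
have rYa d : rmv Y (d, a) = ~~ blocks d z a && ~~ blocks d b a.
  apply/idP/andP => [/and3P[_ _ /forall_inP m]|[za ha]].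
    by split; apply: m; rewrite EY !inE eqxx ?orbT.
  apply/and3P; split=> //=; first by rewrite EY !inE eqxx orbT.
  apply/forall_inP => c; rewrite EY !inE -orbA.
  by case/or3P=> /eqP -> //; rewrite blocks_irr.
have rYb d : rmv Y (d, b) = ~~ blocks d z b && ~~ blocks d a b.
  apply/idP/andP => [/and3P[_ _ /forall_inP m]|[za ha]].
    by split; apply: m; rewrite EY !inE eqxx ?orbT.
  apply/and3P; split=> //=; first by rewrite EY !inE eqxx orbT.
  apply/forall_inP => c; rewrite EY !inE -orbA.
  by case/or3P=> /eqP -> //; rewrite blocks_irr.
have rab d : rmv (Y :\ a) (d, b) = ~~ blocks d z b.
  apply/idP/idP => [/and3P[_ _ /forall_inP m]|zb].
    by apply: m; rewrite EY !inE eqxx eq_sym az.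
  apply/and3P; split=> //=; first by rewrite EY !inE ba eqxx orbT.
  apply/forall_inP => c; rewrite EY !inE -orbA => /andP[ca].
  by case/or3P=> /eqP e; subst c => //; rewrite ?blocks_irr // eqxx in ca *.
have rba d : rmv (Y :\ b) (d, a) = ~~ blocks d z a.
  apply/idP/idP => [/and3P[_ _ /forall_inP m]|zb].
    by apply: m; rewrite EY !inE eqxx eq_sym bz.
  apply/and3P; split=> //=; first by rewrite EY !inE ab eqxx orbT.
  apply/forall_inP => c; rewrite EY !inE -orbA => /andP[ca].
  by case/or3P=> /eqP e; subst c => //; rewrite ?blocks_irr // eqxx in ca *.
have raa d : rmv (Y :\ a) (d, a) = false by rewrite /removable !inE eqxx.
have rbb d : rmv (Y :\ b) (d, b) = false by rewrite /removable !inE eqxx.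
have rY i : rmv Y i -> i.2 = a \/ i.2 = b.
  case/and3P; rewrite EY !inE => iY /negPf iz _; move: iY; rewrite iz /=.
  by case/orP=> /eqP; [left|right].
have rY' c i : rmv (Y :\ c) i -> i.2 = a \/ i.2 = b.
  case/and3P; rewrite EY !inE => /andP[_ iY] /negPf iz _; move: iY; rewrite iz /=.
  by case/orP=> /eqP; [left|right].
pose la u : R := (~~ slt z a)%:R * u (true, a) + (~~ slt a z)%:R * u (false, a).
pose lb u : R := (~~ slt z b)%:R * u (true, b) + (~~ slt b z)%:R * u (false, b).
have fE u : form (atlas le z (fun=> 1 : R) Y) u u =
    if slt a b then (~~ slt z a && ~~ slt z b)%:R * u (true, a) ^+ 2 +
      2 * (~~ slt z a && ~~ slt b z)%:R * u (true, a) * u (false, b) +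
      (~~ slt b z && ~~ slt a z)%:R * u (false, b) ^+ 2
    else 2 * la u * lb u.
  rewrite form_atlas sums; last first.
    move=> i ia ib; rewrite big1 // => k _; case: (boolP (rmv Y i)) => [/rY[]e|_].
    - by rewrite e eqxx in ia.
    - by rewrite e eqxx in ib.
    - by rewrite mul0r.
  have sums2 c x y := sums (fun k => (x && rmv (Y :\ c) k)%:R * (y k)).
  rewrite !sums2; try by move=> i ia ib; case: (boolP (rmv _ i)) => [/rY'[]e|_];
   [rewrite e eqxx in ia | rewrite e eqxx in ib | rewrite andbF mul0r].
  rewrite !raa !rbb !rab !rba /unblocked !rYa !rYb /=.
  rewrite /la /lb nba.
  by case: (slt a b); case: (slt z a); case: (slt a z); case: (slt z b);
    case: (slt b z); rewrite /= ?mul0r ?mul1r ?add0r ?addr0 ?mulr0; ring.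
(* If [a] and [b] are incomparable the form factors, and [l] is one factor. For [a < b] it is a form
   in the two variables [u (true, a)] and [u (false, b)]. *)
pose l (u : bool * T -> R) := if slt a b then
    if ~~ slt z a && ~~ slt z b then u (true, a) + (~~ slt b z)%:R * u (false, b)
    else u (false, b)
  else la u.
apply: (@hyperbolic_of_functional _ _ _ l) => [|u v c|u].
- exact: atlasC.
- by rewrite /l /la; case: ifP => _; [case: ifP => _|]; ring.
rewrite fE /l; case: ifP => [ab'|_ ->]; last by rewrite mulr0 mul0r.
case: (boolP (slt z a)) => [za|za] /=.
  by move=> ->; rewrite expr0n /= !mulr0 !addr0 !mul0r.
move: (u (true, a)) (u (false, b)) => x y.
case: (slt z b) => /=; first by move=> ->; nra.
case: (slt b z) => /=; first by rewrite mul0r addr0 => ->; nra.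
by move=> xy; have -> : x = - y by [lra]; case: (slt a z) => /=; nra.
Qed.

Lemma sum_removable (R : realFieldType) Z (f : bool * T -> R) :
  \sum_(k | rmv Z k) f k = \sum_(a | rmv Z (true, a)) f (true, a) +
    \sum_(b | rmv Z (false, b)) f (false, b).
Proof.
rewrite big_mkcond; transitivity
  (\sum_(i : bool * T) (if rmv Z (i.1, i.2) then f (i.1, i.2) else 0)).
  by apply: eq_bigr => -[].
rewrite -(pair_bigA _ (fun d c => if rmv Z (d, c) then f (d, c) else 0)) big_bool.
by rewrite -!big_mkcond.
Qed.

Lemma lift_num_words (R : realFieldType) (s t : R) n Z : (n.+1 < #|Z|)%N ->
  lift le z (fun i => if i.1 then t else s) (fun Y => (num_words Y n)%:R) Z =
  t * (num_words Z n.+1)%:R + s * (num_words Z n)%:R.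
Proof.
move=> nZ; rewrite /lift sum_removable -!mulr_sumr -!natr_sum.
by rewrite num_words_down // -num_words_up.
Qed.

Lemma card_removable2 Y i k : rmv Y i -> rmv (Y :\ i.2) k ->
  #|Y| = (#|Y :\ i.2 :\ k.2| + 2)%N.
Proof.
move=> /removable_in iY /removable_in kY.
by rewrite (cardsD1 i.2 Y) iY (cardsD1 k.2 (Y :\ _)) kY; lia.
Qed.

Lemma removable2_mem Y i k : z \in Y -> rmv Y i -> rmv (Y :\ i.2) k ->
  z \in Y :\ i.2 :\ k.2.
Proof.
by move=> zY /and3P[_ iz _] /and3P[_ kz _]; rewrite !inE !(eq_sym z) iz kz.
Qed.

Lemma num_words1 : num_words [set z] 0 = 1.
Proof.
rewrite /(num_words _ _) [in LHS]cards1; apply: (etrans _ (cards1 [tuple z])).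
apply: eq_card => w; case/tupleP: w => x w; rewrite (tuple0 w) !inE.
apply/idP/eqP => [/and3P[_ _ /=]|->]; first by have [->|] := eqVneq x z.
by rewrite /= eqxx andbT; apply/eqP/setP => c; rewrite !inE.
Qed.

Theorem hyperbolic_atlas (R : realFieldType) Y n : z \in Y -> (n + 3 <= #|Y|)%N ->
  hyperbolic (atlas le z (fun Z => (num_words Z n)%:R : R) Y).
Proof.
move: {2}#|Y| (erefl #|Y|) => m; elim: m Y n => [|m IH] Y n Ym zY nY; first lia.
have [m3|m3] := ltnP #|Y| 4.
  have [Y3 n0] : #|Y| = 3 /\ n = 0 by lia.
  rewrite n0; apply: (hyperbolic_ext _ (atlas_base zY Y3)).
  apply: eq_atlas => i k ri rk; set Z := _ :\ k.2.
  suff -> : Z = [set z] by rewrite num_words1.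
  apply/esym/eqP; rewrite eqEcard sub1set removable2_mem //= cards1.
  by have := card_removable2 ri rk; rewrite Y3 -/Z; lia.
(* One step below [n], so that the induction hypothesis covers [Y :\ i.2] even when [n + 3 = #|Y|];
   for [n = 0] the assumption [4 <= #|Y|] leaves the room. *)
pose r := n.-1.
have key (s t : R) : 0 < s -> 0 < t -> hyperbolic (atlas le z
   (fun Z => t * (num_words Z r.+1)%:R + s * (num_words Z r)%:R) Y).
  move=> s0 t0; pose h (i : bool * T) := if i.1 then t else s.
  have hk i j : i.1 = j.1 -> h i = h j by rewrite /h => ->.
  have h0 i : 0 < h i by rewrite /h; case: i.1.
  have EA i k : rmv Y i -> rmv (Y :\ i.2) k ->
      lift le z h (fun Z => (num_words Z r)%:R) (Y :\ i.2 :\ k.2) =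
      t * (num_words (Y :\ i.2 :\ k.2) r.+1)%:R +
      s * (num_words (Y :\ i.2 :\ k.2) r)%:R.
    move=> ri rk; apply: lift_num_words.
    by have := card_removable2 ri rk; rewrite /r; lia.
  apply: (@hyperbolic_ext _ _
    (atlas le z (lift le z h (fun Z => (num_words Z r)%:R)) Y)).
    exact: eq_atlas.
  apply: hyperbolic_lift => //.
    (* Each of the two counts is positive on a box of blocker numbers. The union is the larger box
       with these bounds, because its extra corner would need as many blockers as there are
       elements. *)
    pose bound (d : bool) := if d then r.+1 else (#|Y| - 2 - r.+1)%N.
    apply: (support_connected (bound := bound)) => //; rewrite /bound; try by lia.
    move=> i k ri rk; rewrite EA //; have := card_removable2 ri rk.
    have := removable2_mem zY ri rk; set Z := _ :\ k.2 => zZ cZ.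
    have -> A B : (t * A%:R + s * B%:R != 0) = (0 < A)%N || (0 < B)%N.
      rewrite paddr_eq0 ?mulr_ge0 ?ler0n ?ltW // !mulf_eq0 (gt_eqF s0) (gt_eqF t0) /=.
      by rewrite !pnatr_eq0 negb_and -!lt0n.
    have := ltn_blockers le_anti true zZ.
    rewrite !num_words_gt0 // => bb; apply/idP/forallP => [h1 []|h1] /=.
    - by case/orP: h1 => /andP[]; lia.
    - by case/orP: h1 => /andP[]; move: bb; rewrite /=; lia.
    - by have := h1 true; have := h1 false; move: bb; rewrite /=; lia.
  move=> i ri; apply: IH.
  - by move: Ym; rewrite (cardsD1 i.2) (removable_in ri); lia.
  - by have /and3P[_ iz _] := ri; rewrite !inE eq_sym iz.
  - by move: m3 nY; rewrite (cardsD1 i.2 Y) (removable_in ri) /r; lia.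
(* The count at [n] is the lower term of the mixture when [n = 0] and the upper term otherwise. *)
case: n @r key {nY} => [|n] /= key.
  apply: (@hyperbolic_limit _ _ _
    (atlas le z (fun Z => (num_words Z 1)%:R) Y)) => t /andP[t0 t1].
  apply: (hyperbolic_ext _ (key (1 - t) t _ t0)); last by rewrite subr_gt0.
  by move=> i j; rewrite atlasD addrC.
apply: (@hyperbolic_limit _ _ _
  (atlas le z (fun Z => (num_words Z n)%:R) Y)) => t /andP[t0 t1].
apply: (hyperbolic_ext _ (key t (1 - t) t0 _)); last by rewrite subr_gt0.
by move=> i j; rewrite atlasD.
Qed.

End Hyperbolicity.

(** * The equality case *)

Section Equality.

Local Open Scope ring_scope.

Variables (T : finType) (le : rel T).
Hypotheses (le_refl : reflexive le) (le_anti : antisymmetric le)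
  (le_trans : transitive le).
Variable z : T.
Local Notation rmv := (removable le z).
Local Notation slt := (slt le).
Local Notation num_words := (num_words le z).
Local Notation blockers := (blockers le z).
Local Notation lin := (lin le).
Local Notation W := (fun n Y => (num_words Y n)%:R : rat).
Implicit Types (Y Z : {set T}) (i j k : bool * T).

Definition dir (d : bool) i : rat := (i.1 == d)%:R.

Lemma act_dir d n Y i : (n + 3 <= #|Y|)%N ->
  act (atlas le z (W n) Y) (dir d) i =
  (rmv Y i)%:R * (num_words (Y :\ i.2) (n + d)%N)%:R.
Proof.
move=> nY; rewrite act_atlas; case ri: (rmv Y i); rewrite ?mul0r // !mul1r.
transitivity (\sum_(k | rmv (Y :\ i.2) k)
    (num_words (Y :\ i.2 :\ k.2) n)%:R * dir d k).
  apply: eq_bigr => k rk; congr (_ * _).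
  by rewrite (kind_unblocked _ ri rk) // /dir => ? ? ->.
have := cardsD1 i.2 Y; rewrite (removable_in ri) => cY.
rewrite sum_removable -!mulr_suml -!natr_sum /dir /=.
case: d; rewrite mulr1 mulr0 ?addr0 ?add0r.
  by rewrite addn1 num_words_down.
by rewrite addn0 [in RHS]num_words_up //; lia.
Qed.

Lemma form_dir d d' n Y : (n + 3 <= #|Y|)%N ->
  form (atlas le z (W n) Y) (dir d) (dir d') = (num_words Y (n + d + d')%N)%:R.
Proof.
move=> nY; rewrite /form.
transitivity (\sum_(i | rmv Y i) dir d i * (num_words (Y :\ i.2) (n + d')%N)%:R).
  rewrite [RHS]big_mkcond; apply: eq_bigr => i _; rewrite act_dir //.
  by case: (rmv Y i); rewrite ?mul1r // mul0r mulr0.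
rewrite sum_removable -!mulr_sumr -!natr_sum /dir /=.
case: d; rewrite mul1r mul0r ?addr0 ?add0r.
  by rewrite -num_words_down // addn1.
by rewrite -num_words_up ?addn0 //; case: d'; lia.
Qed.

Definition geometric n Y (s : rat) :=
  [/\ 0 < s, (0 < num_words Y n)%N,
   W n.+1 Y = s * W n Y & W n.+2 Y = s * W n.+1 Y].

Lemma geometric_removable n Y s i : z \in Y -> (n + 3 <= #|Y|)%N ->
  geometric n Y s -> rmv Y i ->
  W n.+1 (Y :\ i.2) = s * W n (Y :\ i.2).
Proof.
move=> zY nY [s0 W0 e1 e2] ri.
have := @hyperbolic_eq _ _ (atlas le z (W n) Y) (dir true) (dir false) s
  (@atlasC _ _ _ _ _ _) (hyperbolic_atlas le_refl le_anti le_trans zY nY).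
rewrite !form_dir // !addn0 !addn1 ltr0n W0 => /(_ isT e1 e2 i).
by rewrite !act_dir // ri !mul1r addn1 addn0.
Qed.

Lemma log_concave n Y : z \in Y -> (n + 3 <= #|Y|)%N ->
  (W n Y * W n.+2 Y <= W n.+1 Y ^+ 2).
Proof.
move=> zY nY; have [W0|W0] := posnP (num_words Y n).
  by rewrite W0 mul0r sqr_ge0.
have hyp : hyperbolic (atlas le z (W n) Y) by apply: hyperbolic_atlas.
have := hyp (dir true) (dir false).
by rewrite !form_dir // !addn0 !addn1 mulrC ltr0n; apply.
Qed.

(* By log-concavity all terms [W n.+1 (Y :\ b) - s * W n (Y :\ b)] are
   nonnegative, and by the recursion for [num_words] they sum to zero. *)
Lemma geometric_down n Y s a : z \in Y -> (n + 4 <= #|Y|)%N ->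
  geometric n.+1 Y s -> rmv Y (true, a) ->
  (0 < num_words (Y :\ a) n.+1)%N -> geometric n (Y :\ a) s.
Proof.
move=> zY nY gY ra Wa; have [s0 W0 e1 e2] := gY.
have nY' : (n.+1 + 3 <= #|Y|)%N by lia.
have zYb b : rmv Y (true, b) -> z \in Y :\ b.
  by case/and3P=> /= _ bz _; rewrite !inE eq_sym bz.
have cYb b : rmv Y (true, b) -> #|Y| = #|Y :\ b|.+1.
  by move=> rb; rewrite (cardsD1 b) (removable_in rb).
have E b (rb : rmv Y (true, b)) := geometric_removable zY nY' gY rb.
have ge b : rmv Y (true, b) -> 0 <= W n.+1 (Y :\ b) - s * W n (Y :\ b).
  move=> rb; rewrite subr_ge0.
  have [Wb|Wb] := posnP (num_words (Y :\ b) n.+1); last first.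
    have nb : (n + 3 <= #|Y :\ b|)%N by have := cYb b rb; lia.
    have := log_concave (zYb b rb) nb; rewrite (E b rb) /=.
    have : 0 < W n.+1 (Y :\ b) by rewrite ltr0n.
    rewrite /=; move: (_%:R) (_%:R) => x y y0; nra.
  (* The positive count of [Y] at [n + 3] rules out too many elements above [z]; so the count at
     [n + 1] vanishes because of elements below [z], and then so does the one at [n]. *)
  suff -> : num_words (Y :\ b) n = 0%N by rewrite mulr0.
  have W2 : (0 < num_words Y n.+3)%N.
    by rewrite -(ltr0n rat) e2 e1 !mulr_gt0 // ltr0n.
  apply/eqP; rewrite -leqn0 leqNgt num_words_gt0 ?zYb //.
  move: Wb W2; rewrite num_words_gt0 // => /eqP.
  rewrite -leqn0 leqNgt num_words_gt0 ?zYb //.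
  have := leq_blockers le z false Y b; have := cYb b rb; lia.
have : \sum_(b | rmv Y (true, b)) (W n.+1 (Y :\ b) - s * W n (Y :\ b)) = 0.
  by rewrite sumrB -mulr_sumr -!natr_sum -!num_words_down // e1 subrr.
move/eqP; rewrite psumr_eq0 => [/allP/(_ a (mem_index_enum a))|b]; last exact: ge.
rewrite ra subr_eq0 => /eqP e0; split=> //; last exact: E.
by rewrite -(ltr0n rat) -(pmulr_rgt0 _ s0) -e0 ltr0n.
Qed.

(** Mirror image of [geometric_down]: here the relation between the last two counts is the new one.
    The differences [s * W n.+1 - W n.+2] are nonnegative by log-concavity and sum to zero over the
    last letters. *)
Lemma geometric_up n Y s b : z \in Y -> (n + 4 <= #|Y|)%N ->
  geometric n Y s -> rmv Y (false, b) ->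
  (0 < num_words (Y :\ b) n.+1)%N -> geometric n (Y :\ b) s.
Proof.
move=> zY nY gY rb Wb; have [s0 W0 e1 e2] := gY.
have nY' : (n + 3 <= #|Y|)%N by lia.
have zYb c : rmv Y (false, c) -> z \in Y :\ c.
  by case/and3P=> /= _ bz _; rewrite !inE eq_sym bz.
have cYb c : rmv Y (false, c) -> #|Y| = #|Y :\ c|.+1.
  by move=> rc; rewrite (cardsD1 c) (removable_in rc).
have E c (rc : rmv Y (false, c)) := geometric_removable zY nY' gY rc.
have ge c : rmv Y (false, c) -> 0 <= s * W n.+1 (Y :\ c) - W n.+2 (Y :\ c).
  move=> rc; rewrite subr_ge0.
  have [Wc|Wc] := posnP (num_words (Y :\ c) n); last first.
    have nc : (n + 3 <= #|Y :\ c|)%N by have := cYb c rc; lia.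
    have := log_concave (zYb c rc) nc; rewrite (E c rc) /=.
    have : 0 < W n (Y :\ c) by rewrite ltr0n.
    rewrite /=; move: (_%:R) (_%:R) => x y y0; nra.
  suff -> : num_words (Y :\ c) n.+2 = 0%N by rewrite mulr_ge0 ?ler0n ?(ltW s0).
  apply/eqP; rewrite -leqn0 leqNgt num_words_gt0 ?zYb //.
  move: Wc W0; rewrite num_words_gt0 // => /eqP.
  rewrite -leqn0 leqNgt num_words_gt0 ?zYb //.
  have := leq_blockers le z true Y c; have := cYb c rc; lia.
have : \sum_(c | rmv Y (false, c)) (s * W n.+1 (Y :\ c) - W n.+2 (Y :\ c)) = 0.
  rewrite sumrB -mulr_sumr -!natr_sum -!num_words_up ?e2 ?subrr //; lia.
move/eqP; rewrite psumr_eq0 => [/allP/(_ b (mem_index_enum b))|c]; last exact: ge.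
rewrite rb subr_eq0 => /eqP e0; split=> //; last exact: E.
by rewrite -(ltr0n rat) -(pmulr_rgt0 _ s0) -(E _ rb) ltr0n.
Qed.

(** Strip first letters of [w] until one letter precedes [z], then last letters until three remain.
    What is left of [w] witnesses the positivity that each step requires. *)
Lemma geometric_incomparable n Y s w : z \in Y -> (n + 3 <= #|Y|)%N ->
  geometric n Y s -> lin w -> [set c in w] = Y -> index z w = n.+1 ->
  forall c, index c w = n \/ index c w = n.+2 -> ~~ slt c z && ~~ slt z c.
Proof.
elim: {Y}#|Y| {-2}Y (erefl #|Y|) n w => [|m IH] Y Ym n w zY nY gY lw eY zw c cw.
  lia.
have sw := lin_size le_refl lw eY.
have zYb b : b != z -> z \in Y :\ b by move=> bz; rewrite !inE eq_sym bz.
case: n nY gY zw cw => [|n] nY gY zw cw; last first.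
  case: w lw eY zw cw sw => [|a w] // lw eY; rewrite /=.
  have [//|az [zw]] := eqVneq a z; have [ra lw' eY'] := lin_cons le_refl lw eY az.
  case: eqP => [_ []//|_ cw [sw]].
  apply: (IH (Y :\ a) _ n w) => //.
  - by move: Ym; rewrite (cardsD1 a) (removable_in ra) => -[].
  - exact: zYb.
  - by move: nY; rewrite (cardsD1 a Y) (removable_in ra).
  - by apply: geometric_down => //; [lia | rewrite -zw num_words_pos].
  - by case: cw => -[]; [left | right].
have [Y3|Y4] := leqP #|Y| 3.
  (* Among three letters [z] can stand first and can stand last, so no letter is comparable to
     it. *)
  have [_ W0 e1 e2] := gY; have s0 : 0 < s by case: gY.
  have : (0 < num_words Y 2)%N by rewrite -(ltr0n rat) e2 e1 !mulr_gt0 // ltr0n.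
  move: W0; rewrite !num_words_gt0 // => /andP[b0 _] /andP[_ b1].
  have cY : c \in Y.
    rewrite -eY inE -index_mem sw; lia.
  have none d : blockers d Y = 0%N -> ~~ blocks le d c z.
    move/eqP; rewrite cards_eq0 => /eqP/setP/(_ c).
    by rewrite !inE cY /= => ->.
  rewrite (none true); last lia.
  by rewrite (none false); last lia.
case/lastP: w lw eY zw cw sw => [|w b] // lw eY; rewrite size_rcons.
rewrite -cats1 !index_cat /= => zw cw sw.
have zw' : z \in w.
  by move: zw; case: ifP => // _; rewrite -sw in Y4; case: (b == z); lia.
rewrite zw' in zw.
have bz : b != z.
  apply: contraTneq zw' => <-; have := lin_uniq le_refl lw.
  by rewrite rcons_uniq => /andP[].
have [rb lw' eY'] := lin_rcons le_refl lw eY bz.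
have cw' : c \in w.
  by move: cw; case: ifP => // _; rewrite -sw in Y4; case: (b == c); lia.
rewrite cw' in cw.
apply: (IH (Y :\ b) _ 0%N w) => //.
- by move: Ym; rewrite (cardsD1 b) (removable_in rb) => -[].
- exact: zYb.
- by move: Y4; rewrite (cardsD1 b Y) (removable_in rb).
- by apply: geometric_up => //; have := num_words_pos le_refl z lw' eY'; rewrite zw.
Qed.

End Equality.

(** * Linear extensions with prescribed neighbours *)

Lemma index_rev (T : eqType) (a : T) w : uniq w -> a \in w ->
  index a (rev w) = (size w - (index a w).+1)%N.
Proof.
move=> uw aw; have iw : (index a w < size w)%N by rewrite index_mem.
have kw : (size w - (index a w).+1 < size w)%N by lia.
have <- : nth a (rev w) (size w - (index a w).+1) = a.
  by rewrite nth_rev // subnSK // subKn ?nth_index // ltnW.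
rewrite index_uniq ?rev_uniq ?size_rev // nth_rev // subnSK // subKn.
  by rewrite nth_index.
by rewrite ltnW.
Qed.

Lemma lin_rev (T : finType) (le : rel T) w :
  lin le (rev w) = lin (fun a b => le b a) w.
Proof.
elim: w => [//|a w IH]; rewrite rev_cons /lin pairwise_rcons all_rev /=.
by congr (_ && _); exact: IH.
Qed.

Section Adjacent.

Variables (T : finType) (le : rel T).
Hypotheses (le_refl : reflexive le) (le_anti : antisymmetric le)
  (le_trans : transitive le).
Local Notation slt := (slt le).
Local Notation lin := (lin le).

Lemma exists_lin (Y : {set T}) : exists2 w, lin w & [set c in w] = Y.
Proof.
elim: {Y}#|Y| {-2}Y (erefl #|Y|) => [|m IH] Y Ym.
  by exists [::] => //; rewrite (cards0_eq Ym); apply/setP => c; rewrite !inE.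
have [c cY] : exists c, c \in Y by apply/card_gt0P; rewrite Ym.
have [a aY amin] := exists_unblocked le_anti le_trans true cY.
have [|w lw eY] := IH (Y :\ a).
  by move: Ym; rewrite (cardsD1 a) [_ \in _]aY => -[].
exists (a :: w); last first.
  by rewrite -(setD1K aY) -eY; apply/setP => c'; rewrite !inE.
rewrite /= lw andbT; apply/allP => b bw.
have : b \in Y :\ a by rewrite -eY inE.
by rewrite !inE => /andP[ba /amin]; rewrite /= /(slt _ _) ba.
Qed.

(* Below [x] there is room for everything smaller than a minimal element [y']
   above [x]; putting [x] and [y'] right after the first [m] elements makes
   them adjacent. *)
Lemma exists_adjacent x y m w0 : lin w0 -> [set c in w0] = [set: T] ->
    index x w0 = m -> slt x y -> (#|[set c | slt c y]| <= m.+1)%N ->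
  exists w y', [/\ lin w, [set c in w] = [set: T], index x w = m,
    slt x y' & index y' w = m.+1].
Proof.
move=> lw0 ew0 xw0 xy ym.
have [y' /andP[xy' y'y] ymin] : exists2 y', slt x y' && le y' y &
    forall c, slt x c && le c y -> ~~ slt c y'.
  have Py : slt x y && le y y by rewrite xy le_refl.
  exact: (@exists_unblocked _ _ le_anti le_trans true
    (fun c => slt x c && le c y) y Py).
(* [U] holds what may precede [x]. By minimality of [y'] it contains [B], what must precede [y']
   apart from [x]; an extension of [U] listing [B] first is cut after [m] letters. *)
pose U := [set c | ~~ le x c]; pose B := [set c | slt c y'] :\ x.
have BU : B \subset U.
  apply/subsetP => c; rewrite !inE => /andP[cx cy']; apply/negP => xc.
  have := ymin c; rewrite /(slt _ _) eq_sym cx xc /= -/(slt c y') cy'.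
  by case/andP: cy' => _ cy'; rewrite (le_trans cy' y'y) => /(_ isT).
have mU : (m <= #|U|)%N.
  have xin : x \in w0 by have := in_setT x; rewrite -ew0 inE.
  have sm : size (take m w0) = m by rewrite size_takel // -xw0 index_size.
  have /card_uniqP : uniq (take m w0) by rewrite take_uniq // (lin_uniq le_refl).
  rewrite sm => <-; rewrite -cardsE; apply/subset_leq_card/subsetP => c.
  rewrite !inE => ct; have := lw0; rewrite -(cat_take_drop m w0) /(lin _) pairwise_cat.
  case/and3P=> /allrelP/(_ c x ct) + _ _; apply.
  by rewrite -xw0 (drop_nth x) ?index_mem // nth_index // mem_head.
have [wB lB eB] := exists_lin B; have [wU lU eU] := exists_lin (U :\: B).
have lBU : lin (wB ++ wU).
  rewrite /(lin _) pairwise_cat -!/(lin _) lB lU !andbT; apply/allrelP => a b aB bU.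
  have : a \in B by rewrite -eB inE.
  have : b \in U :\: B by rewrite -eU inE.
  rewrite !inE => /andP[nB xb] /andP[ax ay']; apply: contra nB => ba.
  have bx : b != x by apply: contraNneq xb => ->.
  rewrite bx /=; have [->//|nba] := eqVneq b a.
  by apply: slt_trans ay'; rewrite // /(slt _ _) nba.
have eBU c : (c \in wB ++ wU) = (c \in U).
  have -> : (c \in wB ++ wU) = (c \in [set c in wB] :|: [set c in wU]).
    by rewrite mem_cat !inE.
  rewrite eB eU in_setU in_setD; case cB: (c \in B) => /=; last by [].
  by rewrite (subsetP BU).
have sBU : size (wB ++ wU) = #|U|.
  by rewrite (lin_size le_refl lBU (Y := U)) //; apply/setP => c; rewrite inE eBU.
pose w1 := take m (wB ++ wU).
have sw1 : size w1 = m by rewrite size_takel ?sBU.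
have w1U c : c \in w1 -> ~~ le x c.
  by move/mem_take; rewrite eBU inE.
(* Since [x] is itself below [y'], at most [m] elements remain in [B], and the prefix contains them
   all. *)
have sB : (size wB <= m)%N.
  rewrite (lin_size le_refl lB eB) -ltnS; apply: leq_trans ym.
  have : [set c | slt c y'] \subset [set c | slt c y].
    apply/subsetP => c; rewrite !inE => cy'; have [<-//|ne] := eqVneq y' y.
    by apply: slt_trans cy' _; rewrite // /(slt _ _) ne.
  by move/subset_leq_card; rewrite (cardsD1 x [set c | slt c y']) inE xy'.
have Bw1 c : slt c y' -> c != x -> c \in w1.
  move=> cy' cx; have : c \in [set c in wB] by rewrite eB !inE cx.
  rewrite inE /w1 take_cat; case: ltngtP sB => // [_ _|->] cB.
    by rewrite mem_cat cB.
  by rewrite subnn take0 cats0.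
have [wR lR eR] := exists_lin (~: [set c in x :: y' :: w1]).
have inR c : c \in wR = [&& c != x, c != y' & c \notin w1].
  by have := congr1 (fun A : {set T} => c \in A) eR; rewrite !inE !negb_or => ->.
have y'w1 : y' \notin w1.
  by apply/negP => /w1U; case/andP: xy' => _ ->.
have xw1 : x \notin w1 by apply/negP => /w1U; rewrite le_refl.
exists (w1 ++ x :: y' :: wR), y'; split=> //.
- have := lBU; rewrite -(cat_take_drop m (wB ++ wU)) -/w1.
  rewrite /(lin (_ ++ _ :: _)) /(lin _) !pairwise_cat.
  case/and3P=> /allrelP l12 l1 _; rewrite l1 /= -!/(lin _) lR !andbT.
  apply/and3P; split.
  + apply/allrelP => c e cw1; have xc := w1U _ cw1.
    rewrite !inE => /or3P[/eqP->//|/eqP->|].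
      by apply: contra xc; case/andP: xy' => _; apply: le_trans.
    rewrite inR => /and3P[_ _ ew1].
    have [xe|xe] := boolP (le x e); first by apply: contra xc; apply: le_trans.
    apply: l12 => //; have : e \in wB ++ wU by rewrite eBU inE.
    by rewrite -{1}(cat_take_drop m (wB ++ wU)) mem_cat (negPf ew1).
  + apply/andP; split; first by apply: contraTN xy' => y'x;
      apply/negP; case/andP=> /eqP ne xy'; apply/ne/le_anti; rewrite xy'.
    apply/allP => e; rewrite inR => /and3P[ex _ ew1]; apply: contra ew1 => le_ex.
    by apply: Bw1 => //; apply: slt_trans xy'; rewrite // /(slt _ _) ex.
  + apply/allP => e; rewrite inR => /and3P[ex ey ew1]; apply: contra ew1 => le_ey.
    by apply: Bw1; rewrite // /(slt _ _) ey.
- apply/setP => c; rewrite !inE mem_cat !inE inR.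
  by case: (c \in w1); case: (c == x); case: (c == y').
- by rewrite index_cat (negPf xw1) /= eqxx addn0.
- rewrite index_cat (negPf y'w1) /= eqxx; case: eqP => [e|_]; last by rewrite sw1 addn1.
  by move: xy'; rewrite e slt_irr.
Qed.

End Adjacent.

(** * Words versus linear extensions, swaps and rank bounds *)

Section Extensions.

Variables (d : Order.disp_t) (T : finPOrderType d) (x : T).
Local Notation leT := (<=%O : rel T).
Implicit Types (sigma : {ffun T -> 'I_#|T|}) (w : seq T) (a b : T).

Lemma slt_lt a b : slt leT a b = (a < b)%O.
Proof. by rewrite lt_neqAle. Qed.

Lemma linear_extensionP sigma :
  reflect [/\ injective sigma, forall k, exists a, sigma a = k &
             forall a b, (a <= b)%O -> sigma a <= sigma b]
          (is_linear_extension sigma).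
Proof.
apply: (iffP and3P) => [[/injectiveP inj /forallP sur /forallP mon]|[inj sur mon]].
  split=> // [k|a b ab]; first by have /existsP[a /eqP] := sur k; exists a.
  by have /forallP/(_ b)/implyP/(_ ab) := mon a.
split; first exact/injectiveP.
  by apply/forallP => k; apply/existsP; have [a <-] := sur k; exists a.
by apply/forallP => a; apply/forallP => b; apply/implyP => /mon.
Qed.

Definition word_of_extension sigma : #|T|.-tuple T :=
  [tuple odflt x [pick a | sigma a == k] | k < #|T|].

Definition extension_of_word w : {ffun T -> 'I_#|T|} :=
  [ffun a => insubd (enum_rank x) (index a w)].

Lemma index_word sigma a : is_linear_extension sigma ->
  index a (word_of_extension sigma) = sigma a.
Proof.
case/linear_extensionP=> inj sur mon.
have fK k : sigma (odflt x [pick a | sigma a == k]) = k.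
  case: pickP => [b /eqP//|none]; have [b bk] := sur k.
  by have := none b; rewrite bk eqxx.
have uw : uniq (word_of_extension sigma).
  by rewrite /= map_inj_uniq ?enum_uniq // => j k /(congr1 sigma); rewrite !fK.
have na : nth x (word_of_extension sigma) (sigma a) = a.
  by rewrite -tnth_nth tnth_mktuple; apply: inj; rewrite fK.
by rewrite -[in LHS]na index_uniq // size_tuple.
Qed.

Lemma mem_word sigma a : is_linear_extension sigma ->
  a \in word_of_extension sigma.
Proof. by move=> le; rewrite -index_mem index_word // size_tuple. Qed.

Lemma lin_word sigma : is_linear_extension sigma ->
  lin leT (word_of_extension sigma).
Proof.
move=> le; have /linear_extensionP[inj sur mon] := le.
apply/(pairwiseP x) => i j; rewrite !inE size_tuple => ilt jlt ij.
have sn k : k < #|T| -> sigma (nth x (word_of_extension sigma) k) = k :> nat.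
  move=> kn; have [a ak] := sur (Ordinal kn).
  have ka : k = index a (word_of_extension sigma) by rewrite index_word // ak.
  by rewrite {1}ka nth_index ?mem_word // ak.
by apply/negP => /mon; rewrite !sn // leqNgt ij.
Qed.

Lemma set_word sigma : is_linear_extension sigma ->
  [set c in tval (word_of_extension sigma)] = [set: T].
Proof. by move=> le; apply/setP => c; rewrite !inE mem_word. Qed.

Lemma extension_of_wordE w a : lin leT w -> [set c in w] = [set: T] ->
  extension_of_word w a = index a w :> nat.
Proof.
move=> lw ew; rewrite ffunE val_insubd.
have -> // : index a w < #|T|.
rewrite -cardsT -(lin_size (@le_refl _ _) lw ew) index_mem.
by have := in_setT a; rewrite -ew inE.
Qed.

Lemma extension_of_word_linear w : lin leT w -> [set c in w] = [set: T] ->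
  is_linear_extension (extension_of_word w).
Proof.
move=> lw ew; have eE a := extension_of_wordE a lw ew.
have aw a : a \in w by have := in_setT a; rewrite -ew inE.
have inj : injective (extension_of_word w).
  by move=> a b /(congr1 val)/=; rewrite !eE; apply: index_inj.
apply/linear_extensionP; split=> // [k|a b ab].
  have kw : k < size w by rewrite (lin_size (@le_refl _ _) lw ew) cardsT.
  exists (nth x w k); apply: val_inj; rewrite /= eE index_uniq //.
  exact: lin_uniq (@le_refl _ _) _ lw.
rewrite !eE leqNgt; apply/negP => ba.
have /pairwiseP/(_ _ _ _ _ ba) := lw.
move=> /(_ x); rewrite !inE !index_mem !nth_index // ab.
by move=> /(_ (aw b) (aw a)).
Qed.

Lemma num_linear_extensionsE j :
  num_linear_extensions_at x j.+1 = num_words leT x [set: T] j.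
Proof.
rewrite /num_words /num_linear_extensions_at cardsT.
apply/eqP; rewrite eqn_leq; apply/andP; split.
  rewrite -(card_in_imset (f := word_of_extension)).
    apply/subset_leq_card/subsetP => _ /imsetP[sigma + ->].
    rewrite !inE => /andP[le rk].
    by rewrite lin_word // set_word // index_word // eqxx.
  move=> s t; rewrite !inE => /andP[ls _] /andP[lt _] e.
  by apply/ffunP => a; apply: val_inj; rewrite /= -!index_word // e.
rewrite -(card_in_imset (f := fun w : #|T|.-tuple T => extension_of_word w)).
  apply/subset_leq_card/subsetP => _ /imsetP[w + ->].
  rewrite !inE => /and3P[lw /eqP ew xw].
  by rewrite extension_of_word_linear // /rank extension_of_wordE.
move=> v w; rewrite !inE => /and3P[lv /eqP ev _] /and3P[lw /eqP ew _] e.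
apply: val_inj; apply: (@eq_from_nth _ x) => [|k]; rewrite ?size_tuple // => kn.
have vw a : index a v = index a w.
  by rewrite -!extension_of_wordE // e.
have kv : nth x v k \in w by have := in_setT (nth x v k); rewrite -ew inE.
rewrite -[LHS](nth_index x kv) -vw index_uniq ?size_tuple //.
exact: lin_uniq (@le_refl _ _) _ lv.
Qed.

(** Exchanging adjacent ranks reverses the order of a single pair, [x] and its neighbour. *)
Lemma swap_ranks sigma (k k' : 'I_#|T|) : is_linear_extension sigma ->
    k' = k.+1 :> nat \/ k = k'.+1 :> nat -> sigma x = k ->
    (forall y, sigma y = k' -> (x >< y)%O) ->
  is_linear_extension [ffun a => tperm k k' (sigma a)].
Proof.
case/linear_extensionP=> inj sur mon adj xk inc; apply/linear_extensionP; split.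
- by move=> a b; rewrite !ffunE => /perm_inj /inj.
- move=> j; have [a ja] := sur (tperm k k' j); exists a.
  by rewrite ffunE ja tpermK.
move=> a b ab; have [->//|nab] := eqVneq a b; rewrite !ffunE.
have : sigma a < sigma b.
  by rewrite ltn_neqAle mon // andbT; apply: contra nab => /eqP/val_inj/inj ->.
have sx c : sigma c = k -> c = x by rewrite -xk => /inj.
case: tpermP => [ak|ak'|/eqP ak /eqP ak']; case: tpermP => [bk|bk'|/eqP bk /eqP bk'] //.
- by have := inc b bk'; rewrite -(sx a ak) /Order.comparable ab.
- move: bk bk'; rewrite ak -!val_eqE => /eqP h1 /eqP h2 h3.
  by move: h1 h2 h3 adj => /=; lia.
- by have := inc a ak'; rewrite -(sx b bk) /Order.comparable ab orbT.
- move: bk bk'; rewrite ak' -!val_eqE => /eqP h1 /eqP h2 h3.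
  by move: h1 h2 h3 adj => /=; lia.
- move: ak ak'; rewrite bk -!val_eqE => /eqP h1 /eqP h2 h3.
  by move: h1 h2 h3 adj => /=; lia.
- move: ak ak'; rewrite bk' -!val_eqE => /eqP h1 /eqP h2 h3.
  by move: h1 h2 h3 adj => /=; lia.
- exact: ltnW.
Qed.

Lemma leq_num_swap j j' : j' = j.+1 \/ j = j'.+1 -> 0 < j' <= #|T| ->
    (forall sigma y, is_linear_extension sigma -> rank sigma x = j ->
       rank sigma y = j' -> (x >< y)%O) ->
  num_linear_extensions_at x j <= num_linear_extensions_at x j'.
Proof.
move=> adj /andP[j0 jT] inc.
have [|i_none] := pickP (fun i : 'I_#|T| => i.+1 == j); last first.
  rewrite (_ : num_linear_extensions_at x j = 0) //; apply: eq_card0 => sigma.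
  by rewrite !inE /rank i_none andbF.
move=> k /eqP kj; case: j' adj j0 jT inc => // j' adj _ jT inc.
pose k' := Ordinal jT; rewrite /num_linear_extensions_at.
rewrite -(card_in_imset (D := linear_extensions_at x j)
  (f := fun sigma : {ffun T -> 'I_#|T|} => [ffun a => tperm k k' (sigma a)])).
  apply/subset_leq_card/subsetP => _ /imsetP[sigma + ->].
  rewrite !inE => /andP[le rk]; have xk : sigma x = k.
    by apply/val_inj/eqP; rewrite -eqSS /= kj.
  rewrite swap_ranks //=; first by rewrite /rank ffunE xk tpermL.
    by rewrite -kj in adj; case: adj => [[->]|[->]]; [left|right].
  by move=> y yk; apply: (inc sigma) => //; [exact/eqP | rewrite /rank yk].
move=> s t _ _ /ffunP e; apply/ffunP => a; have := e a.
by rewrite !ffunE => /perm_inj.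
Qed.

Lemma card_below_rank sigma y : is_linear_extension sigma ->
  #|strictly_below y| < rank sigma y.
Proof.
move=> le; have /linear_extensionP[inj sur mon] := le.
rewrite /rank ltnS -[leqRHS](size_takel (s := word_of_extension sigma)); last first.
  by rewrite size_tuple ltnW.
apply: leq_trans (card_size _); apply/subset_leq_card/subsetP => c.
rewrite inE lt_neqAle => /andP[cy lcy].
rewrite in_take ?mem_word // index_word // ltn_neqAle mon // andbT.
by apply: contra cy => /eqP/val_inj/inj ->.
Qed.

Lemma card_above_rank sigma y : is_linear_extension sigma ->
  #|strictly_above y| + rank sigma y <= #|T|.
Proof.
move=> le; have /linear_extensionP[inj sur mon] := le.
have : #|strictly_above y| <= size (drop (rank sigma y) (word_of_extension sigma)).
  apply: leq_trans (card_size _); apply/subset_leq_card/subsetP => c.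
  rewrite inE lt_neqAle => /andP[cy lcy].
  have : c \in tval (word_of_extension sigma) by exact: mem_word.
  rewrite -{1}(cat_take_drop (rank sigma y) (word_of_extension sigma)) mem_cat.
  rewrite in_take ?mem_word // index_word // ltnNge.
  suff -> : rank sigma y <= sigma c by [].
  rewrite /rank ltn_neqAle mon // andbT.
  by apply: contra cy => /eqP/val_inj/inj ->.
by rewrite size_drop size_tuple; have := ltn_ord (sigma y); rewrite /rank; lia.
Qed.

Lemma exists_rank_above sigma y : is_linear_extension sigma -> (x < y)%O ->
    #|strictly_below y| <= rank sigma x ->
  exists sigma' y', [/\ is_linear_extension sigma', rank sigma' x = rank sigma x,
    (x < y')%O & rank sigma' y' = (rank sigma x).+1].
Proof.
move=> le xy by_x.
have [||w [y' [lw ew xw xy' yw]]] := @exists_adjacent _ leT (@le_refl _ _) (@le_anti _ _)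
  (@le_trans _ _) x y _ _ (lin_word le) (set_word le) (index_word x le).
- by rewrite slt_lt.
- by apply: leq_trans by_x; apply/subset_leq_card/subsetP => c; rewrite !inE slt_lt.
exists (extension_of_word w), y'; rewrite /rank !extension_of_wordE // xw yw -slt_lt.
by split=> //; apply: extension_of_word_linear.
Qed.

Lemma exists_rank_below sigma y : is_linear_extension sigma -> (y < x)%O ->
    #|strictly_above y| <= #|T| - rank sigma x + 1 ->
  exists sigma' y', [/\ is_linear_extension sigma', rank sigma' x = rank sigma x,
    (y' < x)%O & (rank sigma' y').+1 = rank sigma x].
Proof.
move=> le yx ay_x; pose geT a b := leT b a.
have lin_ge w : lin geT (rev w) = lin leT w by rewrite lin_rev.
have slt_ge a b : slt geT a b = (b < a)%O by rewrite /slt eq_sym -lt_neqAle.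
have sw := size_tuple (word_of_extension sigma).
have uw := lin_uniq (@le_refl _ _) (lin_word le).
have xT := ltn_ord (sigma x).
(* The dual order and the reversed word, in which [x] has index [#|T| - rank sigma x]. *)
have [||||||||w [y' [lw ew xw xy' yw]]] := @exists_adjacent _ geT _ _
  _ x y (#|T| - rank sigma x) (rev (word_of_extension sigma)).
- by move=> a; apply: le_refl.
- by move=> a b; rewrite andbC; apply: le_anti.
- by move=> a b c ba ac; apply: le_trans ac ba.
- by rewrite lin_ge lin_word.
- by rewrite -(set_word le); apply/setP => c; rewrite !inE mem_rev.
- by rewrite index_rev ?mem_word // sw index_word.
- by rewrite slt_ge.
- rewrite -addn1; apply: leq_trans ay_x.
  by apply/subset_leq_card/subsetP => c; rewrite !inE slt_ge.
have lw' : lin leT (rev w) by rewrite -lin_ge revK.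
have ew' : [set c in rev w] = [set: T].
  by rewrite -ew; apply/setP => c; rewrite !inE mem_rev.
have aw a : a \in w by have := in_setT a; rewrite -ew inE.
have uw' : uniq w by rewrite -rev_uniq (lin_uniq (@le_refl _ _) lw').
have sw' : size w = #|T|.
  by rewrite -size_rev (lin_size (@le_refl _ _) lw' ew') cardsT.
have := aw y'; rewrite -index_mem yw sw' /rank => yT.
exists (extension_of_word (rev w)), y'; rewrite /rank !extension_of_wordE //.
rewrite !index_rev // xw yw sw' -slt_ge; split=> //.
- exact: extension_of_word_linear.
- by rewrite /rank; lia.
- by rewrite /rank in yT *; lia.
Qed.

End Extensions.

(** * The equivalence of the four conditions *)

Unset Implicit Arguments.

Theorem theorem15p3 (d : Order.disp_t) (T : finPOrderType d) (x : T) (i : nat)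
    (n := #|T|) (N := num_linear_extensions_at x)
    (hi : 2 <= i <= n - 1) (hN : 0 < N i) :
  [<-> (* (a) *) N i ^ 2 = N (i + 1) * N (i - 1);
       (* (b) *) N i = N (i + 1) /\ N (i + 1) = N (i - 1);
       (* (c) *) forall sigma : {ffun T -> 'I_n},
           is_linear_extension sigma -> rank sigma x = i ->
           forall z : T, rank sigma z = i - 1 \/ rank sigma z = i + 1 ->
           (z >< x)%O;
       (* (d) *) (forall y : T, y \in strictly_above x ->
                    i < #|strictly_below y|) /\
                 (forall y : T, y \in strictly_below x ->
                    n - i + 1 < #|strictly_above y|)].
Proof.
have lt_incomparable a b : (a < b)%O -> (a >< b)%O -> False.
  by move=> ab; rewrite /Order.comparable (ltW ab).
set A := _ ^ 2 = _; set B := _ /\ _; set C := forall sigma, _; set D := _ /\ _.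
have ac : A -> C.
  rewrite /A /C /N; case: i hi hN @A @B @C @D => [//|[//|p]] hi' hN' _ _ _ _.
  rewrite addn1 !subn1 /= /N !num_linear_extensionsE in hN' * => sq.
  set W := num_words _ x [set: T] in hN' sq.
  (* Equality in (a) and [N i > 0] make both outer counts positive, so the ratio [N i / N (i - 1)]
     exists and is positive. *)
  have [W2 W0] : 0 < W p.+2 /\ 0 < W p.
    by apply/andP; rewrite -muln_gt0 -sq expn_gt0 hN'.
  have gY : geometric <=%O x p [set: T] ((W p.+1)%:R / (W p)%:R)%R.
    have W0' : ((W p)%:R != 0 :> rat)%R by rewrite pnatr_eq0 -lt0n.
    split=> //; first by rewrite divr_gt0 // ltr0n.
      by rewrite -/W divfK.
    by rewrite -/W mulrAC -natrM mulnn sq natrM mulfK.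
  move=> sigma le [xr] z zr.
  have pT : p + 3 <= #|[set: T]| by rewrite cardsT; move: hi'; rewrite -/n; lia.
  have := geometric_incomparable (@le_refl _ _) (@le_anti _ _) (@le_trans _ _)
    (in_setT x) pT gY (lin_word x le) (set_word x le) _ (c := z).
  rewrite !index_word // xr => /(_ erefl); rewrite !slt_lt.
  have zx : z != x.
    by apply/eqP => zx; move: zr xr; rewrite zx /rank; lia.
  have zr' : sigma z = p :> nat \/ sigma z = p.+2 :> nat.
    by move: zr; rewrite /rank; lia.
  move=> /(_ zr') /andP[nzx nxz].
  by rewrite /Order.comparable !le_eqVlt (negPf zx) eq_sym (negPf zx) (negPf nzx).
have cd : C -> D.
  have [sigma] := card_gt0P hN; rewrite inE => /andP[le /eqP xi] c.
  split=> y; rewrite inE ltnNge => xy; apply/negP => card_y.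
    rewrite -xi in card_y.
    have [s [y' [ls xs xy' ys]]] := exists_rank_above le xy card_y.
    rewrite xi in xs ys; have := c s ls xs y'; rewrite ys addn1.
    by move=> /(_ (or_intror erefl)); rewrite comparable_sym; apply: lt_incomparable.
  rewrite -xi in card_y.
  have [s [y' [ls xs xy' ys]]] := exists_rank_below le xy card_y.
  rewrite xi in xs ys; have := c s ls xs y'; rewrite -ys subn1.
  by move=> /(_ (or_introl erefl)); apply: lt_incomparable.
have db : D -> B.
  case=> above below.
  have incomparable (s : {ffun T -> 'I_#|T|}) y : ~ (x < y)%O -> ~ (y < x)%O ->
      rank s x <> rank s y -> (x >< y)%O.
    move=> /negP xy /negP yx xy_rank; rewrite /Order.comparable !le_eqVlt.
    have ne : x != y by apply/eqP => e; apply: xy_rank; rewrite e.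
    by rewrite (negPf ne) eq_sym (negPf ne) (negPf xy) (negPf yx).
  have rank_lt (s : {ffun T -> 'I_#|T|}) a b :
      is_linear_extension s -> (a < b)%O -> rank s a < rank s b.
    move=> /linear_extensionP[inj _ mon]; rewrite lt_neqAle => /andP[ab le_ab].
    rewrite ltn_neqAle ltnS mon // andbT; apply: contra ab.
    by move=> /eqP[] /val_inj /inj ->.
  (* Only [j = i] and [j = i - 1] occur. An element above [x] has more than [i] elements below it,
     hence rank at least [i + 2], and cannot sit at [j + 1]; [down] is the dual. *)
  have up j (s : {ffun T -> 'I_#|T|}) y : is_linear_extension s ->
      rank s x = j -> rank s y = j.+1 -> j <= i -> i <= j.+1 -> (x >< y)%O.
    move=> ls xj yj ji ij; apply: (incomparable s); last lia; move=> h.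
      have := above y; rewrite inE h => /(_ isT).
      by have := card_below_rank x y ls; lia.
    by have := rank_lt _ _ _ ls h; lia.
  have down j (s : {ffun T -> 'I_#|T|}) y : is_linear_extension s ->
      rank s y = j -> rank s x = j.+1 -> j <= i -> i <= j.+1 -> (x >< y)%O.
    move=> ls yj xj ji ij; apply: (incomparable s); last lia; move=> h.
      by have := rank_lt _ _ _ ls h; lia.
    have := below y; rewrite inE h => /(_ isT).
    have := card_above_rank x y ls; rewrite yj -/n => h1 h2; move: h1 h2 ij hi; lia.
  have iE : i = (i - 1).+1 by lia.
  have swap j : j.+1 <= n -> 0 < j -> j <= i -> i <= j.+1 -> N j = N j.+1.
    move=> jn j0 ji ij; apply/eqP; rewrite eqn_leq; apply/andP; split.
      by apply: leq_num_swap => [||s y ls xs ys]; [left | lia | apply: (up j s)].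
    by apply: leq_num_swap => [||s y ls xs ys]; [right | lia | apply: (down j s)].
  have e1 : N i = N i.+1 by apply: swap; lia.
  have e2 : N (i - 1) = N i by rewrite [in RHS]iE; apply: swap; lia.
  by rewrite /B addn1 -e1 e2.
have ba : B -> A by case=> e1 e2; rewrite /A -e2 -e1 expnS expn1.
by tfae; [move/ac/cd/db | move/ba/ac | | move/db/ba].
Qed.
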